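(* Let $(d_k)_{k\ge1}$ and $(N_k)_{k\ge1}$ be sequences of natural numbers such that $(d_k)$ is lacunary, $N_k\mid N_{k+1}$ and $N_k<N_{k+1}$ for all $k$. Then the following conditions are equivalent: (i) there exist constants $a,C$ such that $d_k\le CN_{k+a}$ for all $k$; (ii) there is a constant $c>0$ such that for every $n$ and all trigonometric polynomials $f_1,\dots,f_n\in H^1(\mathbb{T})$ with $\deg f_k\le d_k$, \[\mathbb{E}\Big(\sum_{k=1}^n|f_k|^2\Big)^{1/2}\ge c\,\mathbb{E}\Big(\sum_{k=1}^n|\mathbb{E}^*_{N_k}f_k|^2\Big)^{1/2};\] (iii) there is a constant $c>0$ such that for every $n$ and all trigonometric polynomials $f_1,\dots,f_n\in H^1(\mathbb{T})$ with $\deg f_k\le d_k$, \[\big\|(f_k)_{k=1}^n\big\|_{L^1(\ell^2)}\ge c\,\big\|(\mathbb{E}^*_{N_k}f_k)_{k=1}^n\big\|_{\mathrm{ind}}.\]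
   Context: $\mathbb{T}=\mathbb{R}/2\pi\mathbb{Z}$ with normalized Lebesgue measure $\mu$, and $\mathbb{E}$ denotes integration against $\mu$. $H^1(\mathbb{T})$ is the closed span in $L^1(\mathbb{T})$ of $e^{ijt}$, $j\ge0$. A sequence $(d_k)$ of positive integers is lacunary if $\inf_k d_{k+1}/d_k>1$. For a positive integer $N$, $\mathcal{F}^*_N$ is the $\sigma$-algebra of subsets of $\mathbb{T}$ whose indicator functions are $\frac{2\pi}{N}$-periodic, and $\mathbb{E}^*_N f(t)=\frac1N\sum_{j=0}^{N-1}f(t+\frac{2\pi j}{N})$ is the conditional expectation onto it. For functions $g_1,\dots,g_n$ on $\mathbb{T}$: $\|(g_k)\|_{L^1(\ell^2)}=\mathbb{E}(\sum_k|g_k|^2)^{1/2}$ and $\|(g_k)\|_{\mathrm{ind}}=\int_{\mathbb{T}^n}(\sum_k|g_k(t_k)|^2)^{1/2}\,d\mu(t_1)\cdots d\mu(t_n)$. *)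

(* Defs.v *)
From Stdlib Require Import Reals List.
From Coquelicot Require Import Coquelicot.
Open Scope R_scope.

(* E f = integral of f against normalized Lebesgue measure on T = R/2piZ,
   computed on the fundamental domain [0, 2pi]. *)
Definition torus_E (f : R -> R) : R := RInt f 0 (2 * PI) / (2 * PI).

Definition cexpi (x : R) : C := (cos x, sin x).

(* analytic trigonometric polynomial of degree <= d:
   t |-> sum_{j=0}^{d} a_j e^{i j t}  (these are exactly the trigonometric
   polynomials in H^1(T) of degree <= d) *)
Definition trigpoly (a : nat -> C) (d : nat) (t : R) : C :=
  sum_n (fun j => Cmult (a j) (cexpi (INR j * t))) d.

Definition condexpN (N : nat) (g : R -> C) (t : R) : C :=
  Cmult (RtoC (/ INR N))
        (sum_n (fun m => g (t + 2 * PI * INR m / INR N)) (N - 1)).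

Definition L1l2_norm (g : nat -> R -> C) (n : nat) : R :=
  torus_E (fun t => sqrt (sum_n_m (fun k => (Cmod (g k t)) ^ 2) 1 n)).

Fixpoint ind_aux (g : nat -> R -> C) (ks : list nat) (acc : R) : R :=
  match ks with
  | nil => sqrt acc
  | k :: ks' => torus_E (fun t => ind_aux g ks' (acc + (Cmod (g k t)) ^ 2))
  end.

(* ||(g_k)_{k=1}^n||_ind = int_{T^n} (sum_k |g_k(t_k)|^2)^{1/2} dmu(t_1)...dmu(t_n) *)
Definition ind_norm (g : nat -> R -> C) (n : nat) : R :=
  ind_aux g (List.seq 1 n) 0.

Definition lacunary (d : nat -> nat) : Prop :=
  (forall k, (1 <= k)%nat -> (0 < d k)%nat) /\
  exists q : R, 1 < q /\ forall k, (1 <= k)%nat -> q * INR (d k) <= INR (d (S k)).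

(* Main.v *)
Require Import Defs.
From Stdlib Require Import Reals List Arith Lra Lia Classical.
From Coquelicot Require Import Coquelicot.
Open Scope R_scope.

(** (i) => (ii), (iii).  Put phi_s(x) = sqrt (s^2 + x^2) - s and h_k = E*_{N_k} f_k.
    Splitting the indices into residue classes, one may assume that d_i is much
    smaller than N_k for i < k.  Averaging over the lattice 2 pi Z / N_k and using
    Minkowski's inequality, s_k = E |(f_1, ..., f_k)| is at least
    E sqrt (s'^2 + |h_k|^2), where s' is the mean of |(f'_1, ..., f'_{k-1})| and f'_i
    is obtained from f_i by sampling with a Fejér kernel of order M_k ~ N_k, which
    multiplies the m-th coefficient by 1 - m / M_k.  Iterating, this telescopes to
    sum_k E phi_s(|h_k|) <= C s with s = E |(f_1, ..., f_n)|: the total smoothing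
    undergone by f_i has multiplier prod_k (1 - m / M_k) and is undone, at the cost
    of a bounded factor, by Bernstein's inequality.  As phi_s is subadditive with
    respect to the Euclidean norm and phi_s(x) >= x - s, such a bound controls the
    square function of the h_k for every joint law, in particular both for (ii) and
    for (iii).

    (ii) or (iii) => (i).  If (i) fails, all f_k in a long stretch of indices can be
    taken equal to one modulated Riesz product prod_l (1 + cos (M_l t)), M_l running
    through the N_k.  Then the h_k are the tails of this product.  They have mean 1,
    but E sqrt (h_j h_k) decays geometrically, so the right-hand sides are of order n
    while the left-hand side is sqrt n. *)

(** * Finite sums *)

(* Unlike [sum_n], these sums have exactly [n] terms, so that [n = 0] is allowed. *)
Fixpoint Rsum (n : nat) (f : nat -> R) : R :=
  match n with O => 0 | S k => Rsum k f + f k end.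

Fixpoint Csum (n : nat) (f : nat -> C) : C :=
  match n with O => RtoC 0 | S k => Cplus (Csum k f) (f k) end.

Lemma Rsum_ext n f g :
  (forall j, (j < n)%nat -> f j = g j) -> Rsum n f = Rsum n g.
Proof.
  induction n as [|n IH]; intros H; simpl; auto.
  rewrite IH, H; auto.
Qed.

Lemma Rsum_plus n f g : Rsum n (fun j => f j + g j) = Rsum n f + Rsum n g.
Proof. induction n as [|n IH]; simpl; [lra | rewrite IH; lra]. Qed.

Lemma Rsum_scal n c f : Rsum n (fun j => c * f j) = c * Rsum n f.
Proof. induction n as [|n IH]; simpl; [lra | rewrite IH; lra]. Qed.

Lemma Rsum_le n f g :
  (forall j, (j < n)%nat -> f j <= g j) -> Rsum n f <= Rsum n g.
Proof.
  induction n as [|n IH]; intros H; simpl; [lra|].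
  assert (f n <= g n) by (apply H; lia).
  assert (Rsum n f <= Rsum n g) by (apply IH; intros; apply H; lia). lra.
Qed.

Lemma Rsum_const n c : Rsum n (fun _ => c) = INR n * c.
Proof.
  induction n as [|n IH]; [simpl; lra | rewrite S_INR; simpl Rsum; rewrite IH; lra].
Qed.

Lemma Rsum_nonneg n f : (forall j, (j < n)%nat -> 0 <= f j) -> 0 <= Rsum n f.
Proof.
  intros H. replace 0 with (Rsum n (fun _ => 0)) by (rewrite Rsum_const; lra).
  apply Rsum_le; auto.
Qed.

Lemma Rsum_ge_term n f i :
  (forall j, (j < n)%nat -> 0 <= f j) -> (i < n)%nat -> f i <= Rsum n f.
Proof.
  induction n as [|n IH]; intros H Hi; [lia|]. simpl.
  destruct (Nat.eq_dec i n) as [->|Hne].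
  - assert (0 <= Rsum n f) by (apply Rsum_nonneg; auto). lra.
  - assert (f i <= Rsum n f) by (apply IH; auto; lia).
    assert (0 <= f n) by (apply H; lia). lra.
Qed.

Lemma Rsum_add m n f : Rsum (m + n) f = Rsum m f + Rsum n (fun j => f (m + j)%nat).
Proof.
  induction n as [|n IH]; simpl.
  - rewrite Nat.add_0_r; lra.
  - replace (m + S n)%nat with (S (m + n)) by lia; simpl. rewrite IH; lra.
Qed.

Lemma Rsum_mono m n f :
  (m <= n)%nat -> (forall j, 0 <= f j) -> Rsum m f <= Rsum n f.
Proof.
  intros Hmn H. replace n with (m + (n - m))%nat by lia. rewrite Rsum_add.
  assert (0 <= Rsum (n - m) (fun j => f (m + j)%nat)) by (apply Rsum_nonneg; auto).
  lra.
Qed.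

Lemma Rsum_switch m n (f : nat -> nat -> R) :
  Rsum m (fun i => Rsum n (f i)) = Rsum n (fun j => Rsum m (fun i => f i j)).
Proof.
  induction m as [|m IH]; simpl.
  - rewrite Rsum_const; lra.
  - rewrite IH, <- Rsum_plus. apply Rsum_ext; auto.
Qed.

Lemma Rsum_blocks m n f :
  Rsum (n * m) f = Rsum n (fun i => Rsum m (fun r => f (i * m + r)%nat)).
Proof.
  induction n as [|n IH]; simpl; auto.
  rewrite Nat.add_comm, Rsum_add, IH; auto.
Qed.

Lemma sum_n_m_1_Rsum n f : sum_n_m f 1 n = Rsum n (fun j => f (S j)).
Proof.
  induction n as [|n IH].
  - rewrite sum_n_m_zero; [reflexivity | lia].
  - rewrite sum_n_Sm by lia. rewrite IH. reflexivity.
Qed.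

Lemma sum_n_Csum n (f : nat -> C) : sum_n f n = Csum (S n) f.
Proof.
  induction n as [|n IH].
  - rewrite sum_O. symmetry; apply Cplus_0_l.
  - rewrite sum_Sn, IH. reflexivity.
Qed.

Lemma Csum_ext n f g :
  (forall j, (j < n)%nat -> f j = g j) -> Csum n f = Csum n g.
Proof.
  induction n as [|n IH]; intros H; simpl; auto.
  rewrite IH, H; auto.
Qed.

Lemma Csum_plus n f g :
  Csum n (fun j => Cplus (f j) (g j)) = Cplus (Csum n f) (Csum n g).
Proof. induction n as [|n IH]; simpl; [ring | rewrite IH; ring]. Qed.

Lemma Csum_scal n c f : Csum n (fun j => Cmult c (f j)) = Cmult c (Csum n f).
Proof. induction n as [|n IH]; simpl; [ring | rewrite IH; ring]. Qed.

Lemma Csum_0 n : Csum n (fun _ => RtoC 0) = RtoC 0.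
Proof. induction n as [|n IH]; simpl; [|rewrite IH]; auto; ring. Qed.

Lemma Csum_switch m n (f : nat -> nat -> C) :
  Csum m (fun i => Csum n (f i)) = Csum n (fun j => Csum m (fun i => f i j)).
Proof.
  induction m as [|m IH]; simpl.
  - now rewrite Csum_0.
  - rewrite IH, <- Csum_plus. apply Csum_ext; auto.
Qed.

Lemma Csum_RtoC n f : Csum n (fun j => RtoC (f j)) = RtoC (Rsum n f).
Proof. induction n as [|n IH]; simpl; auto. now rewrite IH, RtoC_plus. Qed.

Lemma Csum_delta n i (x : C) :
  Csum n (fun j => if Nat.eq_dec j i then x else RtoC 0)
  = if lt_dec i n then x else RtoC 0.
Proof.
  induction n as [|n IH]; simpl; auto.
  rewrite IH. destruct (Nat.eq_dec n i); destruct (lt_dec i n);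
    destruct (lt_dec i (S n)); try lia; ring.
Qed.

Lemma Re_Csum n f : Re (Csum n f) = Rsum n (fun j => Re (f j)).
Proof. induction n as [|n IH]; simpl; auto. rewrite <- IH; reflexivity. Qed.

Lemma Im_Csum n f : Im (Csum n f) = Rsum n (fun j => Im (f j)).
Proof. induction n as [|n IH]; simpl; auto. rewrite <- IH; reflexivity. Qed.

Lemma Cmod_Csum n f : Cmod (Csum n f) <= Rsum n (fun j => Cmod (f j)).
Proof.
  induction n as [|n IH]; simpl.
  - rewrite Cmod_0; lra.
  - eapply Rle_trans; [apply Cmod_triangle | lra].
Qed.

(** * Continuous functions on the torus *)

(** Continuity and periodicity together give integrability on every interval and invariance of
    [torus_E] under translation. Both survive the operations used below, so no measurability
    argument arises. *)
Definition cper (f : R -> R) : Prop :=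
  (forall x, continuous f x) /\ (forall x, f (x + 2 * PI) = f x).

Lemma cper_const c : cper (fun _ => c).
Proof. split; intros; auto. apply continuous_const. Qed.

Lemma cper_ext f g : (forall x, f x = g x) -> cper f -> cper g.
Proof.
  intros H [Hc Hp]; split; intros x.
  - apply continuous_ext with f; auto.
  - rewrite <- !H; auto.
Qed.

Lemma cper_plus f g : cper f -> cper g -> cper (fun x => f x + g x).
Proof.
  intros [Hc Hp] [Gc Gp]; split; intros x.
  - apply (@continuous_plus _ R_AbsRing R_NormedModule); auto.
  - now rewrite Hp, Gp.
Qed.

Lemma cper_mult f g : cper f -> cper g -> cper (fun x => f x * g x).
Proof.
  intros [Hc Hp] [Gc Gp]; split; intros x.
  - apply (@continuous_mult _ R_AbsRing); auto.
  - now rewrite Hp, Gp.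
Qed.

Lemma cper_opp f : cper f -> cper (fun x => - f x).
Proof.
  intros H. apply cper_ext with (fun x => -1 * f x); [intros; lra|].
  apply cper_mult; auto; apply cper_const.
Qed.

Lemma cper_minus f g : cper f -> cper g -> cper (fun x => f x - g x).
Proof. intros; apply cper_plus; auto; now apply cper_opp. Qed.

Lemma cper_comp (h : R -> R) f :
  (forall x, continuous h x) -> cper f -> cper (fun x => h (f x)).
Proof.
  intros Hh [Hc Hp]; split; intros x.
  - apply (continuous_comp f h); auto.
  - now rewrite Hp.
Qed.

Lemma cper_sqrt f : cper f -> cper (fun x => sqrt (f x)).
Proof. apply cper_comp, continuous_sqrt. Qed.

Lemma cper_pow2 f : cper f -> cper (fun x => f x ^ 2).
Proof.
  intros H. apply cper_ext with (fun x => f x * f x); [intros; ring|].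
  now apply cper_mult.
Qed.

Lemma cper_sum n (f : nat -> R -> R) :
  (forall j, (j < n)%nat -> cper (f j)) -> cper (fun x => Rsum n (fun j => f j x)).
Proof.
  induction n as [|n IH]; intros H; simpl; [apply cper_const|].
  apply cper_plus; auto.
Qed.

Lemma cper_shift f c : cper f -> cper (fun x => f (x + c)).
Proof.
  intros [Hc Hp]; split; intros x.
  - apply (continuous_comp (fun x => x + c) f); auto.
    apply (@continuous_plus _ R_AbsRing R_NormedModule);
      [apply continuous_id | apply continuous_const].
  - rewrite <- (Hp (x + c)); f_equal; ring.
Qed.

Lemma cper_cos_sin (m : nat) (c : R) :
  cper (fun x => cos (INR m * x + c)) /\ cper (fun x => sin (INR m * x + c)).
Proof.
  assert (Hlin : forall x, continuous (fun x => INR m * x + c) x).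
  { intros x. apply (@continuous_plus _ R_AbsRing R_NormedModule);
      [|apply continuous_const].
    apply (@continuous_mult _ R_AbsRing);
      [apply continuous_const | apply continuous_id]. }
  split; split; intros x.
  - now apply continuous_cos_comp.
  - replace (INR m * (x + 2 * PI) + c) with (INR m * x + c + 2 * INR m * PI) by ring.
    apply cos_period.
  - now apply continuous_sin_comp.
  - replace (INR m * (x + 2 * PI) + c) with (INR m * x + c + 2 * INR m * PI) by ring.
    apply sin_period.
Qed.

Lemma cper_ex_RInt f a b : cper f -> ex_RInt f a b.
Proof. intros [Hc _]. apply (@ex_RInt_continuous R_CompleteNormedModule); auto. Qed.

Lemma two_PI_pos : 0 < 2 * PI.
Proof. pose proof PI_RGT_0; lra. Qed.

Lemma torus_E_ext f g : (forall x, f x = g x) -> torus_E f = torus_E g.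
Proof.
  intros H. unfold torus_E. f_equal. apply RInt_ext; auto.
Qed.

Lemma torus_E_const c : torus_E (fun _ => c) = c.
Proof.
  unfold torus_E. rewrite RInt_const. pose proof two_PI_pos.
  unfold scal; simpl; unfold mult; simpl. field. lra.
Qed.

Lemma torus_E_plus f g :
  cper f -> cper g -> torus_E (fun x => f x + g x) = torus_E f + torus_E g.
Proof.
  intros Hf Hg. unfold torus_E.
  rewrite (RInt_plus f g) by (now apply cper_ex_RInt).
  unfold plus; simpl. pose proof two_PI_pos. field; lra.
Qed.

Lemma torus_E_scal c f : cper f -> torus_E (fun x => c * f x) = c * torus_E f.
Proof.
  intros Hf. unfold torus_E.
  rewrite (RInt_scal f) by (now apply cper_ex_RInt).
  unfold scal; simpl; unfold mult; simpl. pose proof two_PI_pos. field; lra.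
Qed.

Lemma torus_E_minus f g :
  cper f -> cper g -> torus_E (fun x => f x - g x) = torus_E f - torus_E g.
Proof.
  intros Hf Hg.
  rewrite (torus_E_ext _ (fun x => f x + (-1) * g x)) by (intros; ring).
  rewrite torus_E_plus, torus_E_scal; auto; [ring|].
  apply cper_mult; auto; apply cper_const.
Qed.

Lemma torus_E_sum n (f : nat -> R -> R) :
  (forall j, (j < n)%nat -> cper (f j)) ->
  torus_E (fun x => Rsum n (fun j => f j x)) = Rsum n (fun j => torus_E (f j)).
Proof.
  induction n as [|n IH]; intros H; simpl; [apply torus_E_const|].
  rewrite torus_E_plus; auto; [rewrite IH; auto|]. apply cper_sum; auto.
Qed.

Lemma torus_E_le f g :
  cper f -> cper g -> (forall x, f x <= g x) -> torus_E f <= torus_E g.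
Proof.
  intros Hf Hg H. unfold torus_E, Rdiv. apply Rmult_le_compat_r.
  - left; apply Rinv_0_lt_compat, two_PI_pos.
  - apply RInt_le; try (now apply cper_ex_RInt); auto.
    left; apply two_PI_pos.
Qed.

Lemma torus_E_ge_const c f : cper f -> (forall x, c <= f x) -> c <= torus_E f.
Proof.
  intros Hf H. rewrite <- (torus_E_const c). apply torus_E_le; auto. apply cper_const.
Qed.

(** Moving [[0, 2 pi]] by [c] trades [[0, c]] for [[2 pi, 2 pi + c]], over which the integral is the
    same by periodicity. *)
Lemma torus_E_shift f c : cper f -> torus_E (fun x => f (x + c)) = torus_E f.
Proof.
  intros Hf. unfold torus_E. f_equal.
  assert (Hi : forall a b, ex_RInt f a b) by (intros; now apply cper_ex_RInt).
  assert (Hlin : forall v, RInt (fun x => f (x + v)) 0 (2 * PI)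
                           = RInt f v (2 * PI + v)).
  { intros v. pose proof (RInt_comp_lin f 1 v 0 (2 * PI) (Hi _ _)) as H.
    replace (1 * 0 + v) with v in H by ring.
    replace (1 * (2 * PI) + v) with (2 * PI + v) in H by ring.
    rewrite <- H. apply RInt_ext. intros x _.
    unfold scal; simpl; unfold mult; simpl.
    replace (1 * x + v) with (x + v) by ring. ring. }
  rewrite Hlin.
  assert (H2 : RInt f (2 * PI) (2 * PI + c) = RInt f 0 c).
  { pose proof (RInt_comp_lin f 1 (2 * PI) 0 c (Hi _ _)) as H.
    replace (1 * 0 + 2 * PI) with (2 * PI) in H by ring.
    replace (1 * c + 2 * PI) with (2 * PI + c) in H by ring.
    rewrite <- H. apply RInt_ext. intros x _.
    unfold scal; simpl; unfold mult; simpl.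
    replace (1 * x + 2 * PI) with (x + 2 * PI) by ring.
    destruct Hf as [_ Hp]. rewrite Hp. ring. }
  pose proof (RInt_Chasles f 0 c (2 * PI + c) (Hi _ _) (Hi _ _)) as H3.
  pose proof (RInt_Chasles f 0 (2 * PI) (2 * PI + c) (Hi _ _) (Hi _ _)) as H4.
  unfold plus in H3, H4; simpl in H3, H4. lra.
Qed.

Lemma torus_E_cos (m : nat) (c : R) :
  (0 < m)%nat -> torus_E (fun x => cos (INR m * x + c)) = 0.
Proof.
  intros Hm. unfold torus_E.
  assert (Hm' : INR m <> 0) by (apply not_0_INR; lia).
  assert (H : is_RInt (fun x => cos (INR m * x + c)) 0 (2 * PI)
     (minus (/ INR m * sin (INR m * (2 * PI) + c)) (/ INR m * sin (INR m * 0 + c)))).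
  { apply (is_RInt_derive (fun x => / INR m * sin (INR m * x + c))).
    - intros x _. auto_derive; auto. field. auto.
    - intros x _. apply (proj1 (cper_cos_sin m c)). }
  rewrite (is_RInt_unique _ _ _ _ H).
  replace (INR m * (2 * PI) + c) with (INR m * 0 + c + 2 * INR m * PI) by ring.
  rewrite sin_period. unfold minus, plus, opp; simpl.
  pose proof two_PI_pos. field. split; auto; lra.
Qed.

(** * Exponential sums and the Fejér kernel *)

(** Points of the lattice [2 pi Z / N], in the very form in which they occur in [condexpN]. *)
Definition node (N j : nat) : R := 2 * PI * INR j / INR N.

Lemma cexpi_plus x y : cexpi (x + y) = Cmult (cexpi x) (cexpi y).
Proof.
  unfold cexpi, Cmult; simpl. rewrite cos_plus, sin_plus. f_equal; ring.
Qed.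

Lemma cexpi_0 : cexpi 0 = RtoC 1.
Proof. unfold cexpi. now rewrite cos_0, sin_0. Qed.

Lemma cexpi_opp x : cexpi (- x) = Cconj (cexpi x).
Proof. unfold cexpi, Cconj; simpl. now rewrite cos_neg, sin_neg. Qed.

Lemma Cmod_cexpi x : Cmod (cexpi x) = 1.
Proof.
  unfold Cmod, cexpi; simpl fst; simpl snd.
  replace (cos x ^ 2 + sin x ^ 2) with 1; [apply sqrt_1|].
  pose proof (sin2_cos2 x) as H; unfold Rsqr in H. lra.
Qed.

Lemma cos_lattice_sum (N k : nat) (c : R) :
  (0 < k < N)%nat -> Rsum N (fun j => cos (c + INR k * node N j)) = 0.
Proof.
  intros Hk.
  assert (HN : 0 < INR N) by (apply lt_0_INR; lia).
  set (h := PI * INR k / INR N).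
  (* multiplying by 2 sin h makes the sum telescope *)
  assert (Htel : forall n, 2 * sin h * Rsum n (fun j => cos (c + INR k * node N j))
                 = sin (c + (2 * INR n - 1) * h) - sin (c - h)).
  { induction n as [|n IH].
    - simpl. replace (c + (2 * 0 - 1) * h) with (c - h) by ring. ring.
    - simpl Rsum. rewrite Rmult_plus_distr_l, IH, S_INR.
      replace (c + INR k * node N n) with (c + 2 * INR n * h)
        by (unfold h, node; field; lra).
      replace (c + (2 * (INR n + 1) - 1) * h) with (c + 2 * INR n * h + h) by ring.
      replace (c + (2 * INR n - 1) * h) with (c + 2 * INR n * h - h) by ring.
      rewrite sin_plus, sin_minus. ring. }
  specialize (Htel N).
  replace (c + (2 * INR N - 1) * h) with (c - h + 2 * INR k * PI) in Htel
    by (unfold h; field; lra).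
  rewrite sin_period in Htel.
  assert (Hs : 0 < sin h).
  { assert (0 < INR k) by (apply lt_0_INR; lia).
    assert (INR k < INR N) by (apply lt_INR; lia).
    pose proof PI_RGT_0.
    apply sin_gt_0; unfold h.
    - apply Rdiv_lt_0_compat; auto. now apply Rmult_lt_0_compat.
    - apply Rmult_lt_reg_r with (INR N); auto. unfold Rdiv.
      rewrite Rmult_assoc, Rinv_l by lra. rewrite Rmult_1_r.
      now apply Rmult_lt_compat_l. }
  apply Rmult_eq_reg_l with (2 * sin h); lra.
Qed.

Lemma C_eq (x y : C) : Re x = Re y -> Im x = Im y -> x = y.
Proof. destruct x, y; simpl; intros; subst; auto. Qed.

(** Real and imaginary parts are cosine sums whose phases differ by [pi / 2]. The integer frequency
    is written as a difference of naturals, and the hypotheses say that [0 < |a - b| < N]. *)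
Lemma cexpi_lattice_sum (N a b : nat) (c : R) :
  a <> b -> (a < b + N)%nat -> (b < a + N)%nat ->
  Csum N (fun j => cexpi (c + (INR a - INR b) * node N j)) = RtoC 0.
Proof.
  intros Hab Ha Hb.
  assert (Hcos : forall c, Rsum N (fun j => cos (c + (INR a - INR b) * node N j)) = 0).
  { intros c'. destruct (Nat.lt_ge_cases b a) as [Hlt|Hge].
    - rewrite <- (cos_lattice_sum N (a - b) c') by lia.
      apply Rsum_ext; intros. now rewrite minus_INR by lia.
    - rewrite <- (cos_lattice_sum N (b - a) (- c')) by lia.
      apply Rsum_ext; intros. rewrite minus_INR by lia.
      rewrite <- cos_neg. f_equal; ring. }
  apply C_eq.
  - rewrite Re_Csum. simpl. apply Hcos.
  - rewrite Im_Csum. simpl. rewrite <- (Hcos (c - PI / 2)).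
    apply Rsum_ext; intros. rewrite <- cos_shift, <- cos_neg. f_equal; ring.
Qed.

(** The Fejér kernel, written as the squared modulus of a geometric sum so that its positivity is
    immediate. Its coefficient at frequency [k] is [1 - |k| / M] for [|k| < M]. *)
Definition fejer (M : nat) (v : R) : R :=
  Cmod (Csum M (fun p => cexpi (INR p * v))) ^ 2 / INR M.

Lemma fejer_nonneg M v : (0 < M)%nat -> 0 <= fejer M v.
Proof.
  intros HM. unfold fejer. apply Rmult_le_pos; [apply pow2_ge_0|].
  left; apply Rinv_0_lt_compat, lt_0_INR; auto.
Qed.

Lemma Cconj_Csum n f : Cconj (Csum n f) = Csum n (fun j => Cconj (f j)).
Proof.
  induction n as [|n IH]; simpl.
  - unfold Cconj, RtoC; simpl. now rewrite Ropp_0.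
  - now rewrite Cplus_conj, IH.
Qed.

Lemma Csum_mult n f g :
  Cmult (Csum n f) (Csum n g) = Csum n (fun p => Csum n (fun q => Cmult (f p) (g q))).
Proof.
  rewrite Cmult_comm, <- Csum_scal. apply Csum_ext; intros.
  now rewrite Cmult_comm, Csum_scal.
Qed.

Lemma fejer_expand M v :
  RtoC (fejer M v)
  = Cmult (RtoC (/ INR M))
      (Csum M (fun p => Csum M (fun q => cexpi ((INR p - INR q) * v)))).
Proof.
  unfold fejer, Rdiv. rewrite Rmult_comm, RtoC_mult, Cmod2_conj, Cconj_Csum, Csum_mult.
  f_equal. apply Csum_ext; intros p _. apply Csum_ext; intros q _.
  rewrite <- cexpi_opp, <- cexpi_plus. f_equal; ring.
Qed.

(* No aliasing occurs: the frequencies [m + q - p] have modulus smaller than [N]. *)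
Lemma fejer_sampling (N M m : nat) (t u : R) :
  (0 < M)%nat -> (m <= M)%nat -> (M + m <= N)%nat ->
  Csum N (fun j => Cmult (cexpi (INR m * (t + node N j)))
                     (RtoC (fejer M (u - (t + node N j)))))
  = Cmult (RtoC (INR N * (1 - INR m / INR M))) (cexpi (INR m * u)).
Proof.
  intros HM Hm HN.
  assert (HM' : INR M <> 0) by (apply not_0_INR; lia).
  rewrite (Csum_ext _ _ (fun j => Csum M (fun p => Csum M (fun q =>
     Cmult (RtoC (/ INR M)) (cexpi ((INR m * t + (INR p - INR q) * (u - t))
             + (INR (m + q) - INR p) * node N j)))))).
  2: { intros j _. rewrite fejer_expand, Cmult_assoc, (Cmult_comm (cexpi _)).
       rewrite <- Cmult_assoc, <- Csum_scal, <- Csum_scal.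
       apply Csum_ext; intros p _. rewrite <- !Csum_scal.
       apply Csum_ext; intros q _. rewrite <- cexpi_plus, plus_INR.
       f_equal. f_equal. ring. }
  rewrite Csum_switch.
  (* Orthogonality on the lattice leaves only the pairs with [p = m + q]; there are [M - m] of
     them. *)
  rewrite (Csum_ext _ _ (fun p => Csum M (fun q =>
     Cmult (Cmult (RtoC (INR N / INR M)) (cexpi (INR m * u)))
       (if Nat.eq_dec p (m + q) then RtoC 1 else RtoC 0)))).
  2: { intros p Hp. rewrite Csum_switch. apply Csum_ext; intros q Hq.
       rewrite Csum_scal. destruct (Nat.eq_dec p (m + q)) as [->|Hne].
       - rewrite (Csum_ext _ _ (fun _ => Cmult (cexpi (INR m * u)) (RtoC 1))).
         + rewrite Csum_scal, Csum_RtoC, Rsum_const, Rmult_1_r.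
           unfold Rdiv. rewrite RtoC_mult. ring.
         + intros j _. rewrite Cmult_1_r. f_equal. rewrite plus_INR. ring.
       - rewrite cexpi_lattice_sum by lia. ring. }
  rewrite Csum_switch.
  rewrite (Csum_ext _ _ (fun q =>
     Cmult (Cmult (RtoC (INR N / INR M)) (cexpi (INR m * u)))
       (RtoC (if lt_dec (m + q) M then 1 else 0)))).
  2: { intros q _. rewrite Csum_scal, Csum_delta.
       destruct (lt_dec (m + q) M); auto. }
  rewrite Csum_scal, Csum_RtoC.
  replace (Rsum M (fun q => if lt_dec (m + q) M then 1 else 0)) with (INR (M - m)).
  - rewrite minus_INR by lia.
    replace (INR N * (1 - INR m / INR M)) with (INR N / INR M * (INR M - INR m))
      by (field; auto).
    rewrite RtoC_mult. ring.
  - assert (H : forall K, (K <= M)%nat ->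
      Rsum K (fun q => if lt_dec (m + q) M then 1 else 0)
      = INR (Nat.min K (M - m))).
    { induction K as [|K IH]; intros HK; [reflexivity|].
      simpl Rsum. rewrite IH by lia. destruct (lt_dec (m + K) M).
      - rewrite !Nat.min_l by lia. now rewrite S_INR.
      - rewrite !Nat.min_r by lia. lra. }
    rewrite H by lia. f_equal. lia.
Qed.

Definition ccper (f : R -> C) : Prop :=
  cper (fun x => Re (f x)) /\ cper (fun x => Im (f x)).

Lemma ccper_const c : ccper (fun _ => c).
Proof. split; apply cper_const. Qed.

Lemma ccper_mult f g : ccper f -> ccper g -> ccper (fun x => Cmult (f x) (g x)).
Proof.
  intros [Fr Fi] [Gr Gi]; split; simpl.
  - apply cper_minus; now apply cper_mult.
  - apply cper_plus; now apply cper_mult.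
Qed.

Lemma ccper_Csum n (f : nat -> R -> C) :
  (forall j, ccper (f j)) -> ccper (fun x => Csum n (fun j => f j x)).
Proof.
  intros H; split.
  - eapply cper_ext; [intros x; symmetry; apply Re_Csum|].
    apply cper_sum; intros; apply H.
  - eapply cper_ext; [intros x; symmetry; apply Im_Csum|].
    apply cper_sum; intros; apply H.
Qed.

Lemma ccper_shift f c : ccper f -> ccper (fun x => f (x + c)).
Proof.
  intros [Hr Hi]; split.
  - exact (cper_shift _ c Hr).
  - exact (cper_shift _ c Hi).
Qed.

Lemma ccper_cexpi m : ccper (fun x => cexpi (INR m * x)).
Proof.
  destruct (cper_cos_sin m 0) as [Hc Hs]. split.
  - eapply cper_ext; [|exact Hc]. intros x; simpl. now rewrite Rplus_0_r.
  - eapply cper_ext; [|exact Hs]. intros x; simpl. now rewrite Rplus_0_r.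
Qed.

Lemma cper_Cmod f : ccper f -> cper (fun x => Cmod (f x)).
Proof.
  intros [Hr Hi]. unfold Cmod. apply cper_sqrt.
  apply cper_plus; now apply cper_pow2.
Qed.

Lemma cper_fejer M : cper (fejer M).
Proof.
  unfold fejer, Rdiv. apply cper_mult; [|apply cper_const].
  apply cper_pow2, cper_Cmod, ccper_Csum. intros; apply ccper_cexpi.
Qed.

(** The case [m = 0] of the sampling formula. *)
Lemma fejer_lattice_sum (N M : nat) (t u : R) :
  (0 < M)%nat -> (M <= N)%nat ->
  Rsum N (fun j => fejer M (u - (t + node N j))) = INR N.
Proof.
  intros HM HN. apply RtoC_inj. rewrite <- Csum_RtoC.
  transitivity (Cmult (RtoC (INR N * (1 - INR 0 / INR M))) (cexpi (INR 0 * u))).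
  - rewrite <- (fejer_sampling N M 0 t u) by lia.
    apply Csum_ext; intros. simpl INR. rewrite Rmult_0_l, cexpi_0. ring.
  - simpl INR. rewrite Rmult_0_l, cexpi_0. unfold Rdiv.
    rewrite Rmult_0_l, Rminus_0_r, Rmult_1_r. ring.
Qed.

(** Integrating the lattice identity in [u] avoids computing coefficients: all [M] translates have
    the same integral and their sum is the constant [M]. *)
Lemma torus_E_fejer M : (0 < M)%nat -> torus_E (fejer M) = 1.
Proof.
  intros HM.
  assert (Hs : forall c, cper (fun u => fejer M (u - c)))
    by (intros c; apply (cper_shift _ (- c)), cper_fejer).
  assert (H : torus_E (fun u => Rsum M (fun j => fejer M (u - (0 + node M j))))
              = INR M).
  { rewrite (torus_E_ext _ (fun _ => INR M)); [apply torus_E_const|].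
    intros u. apply fejer_lattice_sum; lia. }
  rewrite (torus_E_sum M (fun j u => fejer M (u - (0 + node M j)))) in H by auto.
  rewrite (Rsum_ext _ _ (fun _ => torus_E (fejer M))) in H.
  - rewrite Rsum_const in H. apply Rmult_eq_reg_l with (INR M); [lra|].
    apply not_0_INR; lia.
  - intros j _. apply (torus_E_shift (fejer M) (- (0 + node M j))), cper_fejer.
Qed.

(** * Sampling of analytic polynomials and Bernstein's inequality *)

(** On frequencies [m <= M] this is convolution with the Fejér kernel of order [M]. *)
Definition smooth (M : nat) (a : nat -> C) (m : nat) : C :=
  Cmult (RtoC (1 - INR m / INR M)) (a m).

Lemma trigpoly_Csum a d t :
  trigpoly a d t = Csum (S d) (fun j => Cmult (a j) (cexpi (INR j * t))).
Proof. unfold trigpoly. apply sum_n_Csum. Qed.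

Lemma condexpN_Csum N g t :
  (0 < N)%nat ->
  condexpN N g t = Cmult (RtoC (/ INR N)) (Csum N (fun j => g (t + node N j))).
Proof.
  intros HN. unfold condexpN. rewrite sum_n_Csum.
  now replace (S (N - 1)) with N by lia.
Qed.

Lemma ccper_trigpoly a d : ccper (trigpoly a d).
Proof.
  assert (H : ccper (fun t => Csum (S d) (fun j => Cmult (a j) (cexpi (INR j * t))))).
  { apply ccper_Csum. intros j. apply ccper_mult; [apply ccper_const|].
    apply ccper_cexpi. }
  destruct H as [Hr Hi].
  split; (eapply cper_ext; [intros x; rewrite trigpoly_Csum; reflexivity | assumption]).
Qed.

Lemma ccper_condexpN N g : (0 < N)%nat -> ccper g -> ccper (condexpN N g).
Proof.
  intros HN Hg.
  assert (H : ccper (fun t => Cmult (RtoC (/ INR N)) (Csum N (fun j => g (t + node N j))))).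
  { apply ccper_mult; [apply ccper_const|].
    apply (ccper_Csum N (fun j t => g (t + node N j))).
    intros; now apply ccper_shift. }
  destruct H as [Hr Hi].
  split; (eapply cper_ext; [intros x; rewrite condexpN_Csum by auto; reflexivity
                           | assumption]).
Qed.

(** The smoothed polynomial at any point [u] is a positive combination of samples on the coset of
    [t]. The weights do not depend on the polynomial, so Minkowski's inequality can be applied to
    several polynomials at once. *)
Lemma trigpoly_sampling (N M d : nat) (a : nat -> C) (t u : R) :
  (0 < M)%nat -> (d <= M)%nat -> (M + d <= N)%nat ->
  Csum N (fun j => Cmult (trigpoly a d (t + node N j))
                     (RtoC (fejer M (u - (t + node N j)))))
  = Cmult (RtoC (INR N)) (trigpoly (smooth M a) d u).
Proof.
  intros HM Hd HN.
  rewrite (Csum_ext _ _ (fun j => Csum (S d) (fun m => Cmult (a m)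
     (Cmult (cexpi (INR m * (t + node N j))) (RtoC (fejer M (u - (t + node N j)))))))).
  2: { intros j _. rewrite trigpoly_Csum, Cmult_comm, <- Csum_scal.
       apply Csum_ext; intros; ring. }
  rewrite Csum_switch, trigpoly_Csum, <- Csum_scal.
  apply Csum_ext; intros m Hm.
  rewrite Csum_scal, fejer_sampling by lia. unfold smooth. rewrite RtoC_mult. ring.
Qed.

(* On the frequencies [0 <= m <= d] the Fejér kernel of order [d], modulated by
   [exp (i d t)], has Fourier coefficients [m / d]: this is Bernstein's inequality
   for analytic polynomials, written as an average of translates. *)
Lemma smooth_translates (d M : nat) :
  (0 < d)%nat -> (0 < M)%nat ->
  exists (Q : nat) (w : nat -> C) (x : nat -> R),
    Rsum Q (fun j => Cmod (w j)) = 1 /\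
    forall a t, trigpoly a d t
      = Cplus (trigpoly (smooth M a) d t)
          (Cmult (RtoC (INR d / INR M))
             (Csum Q (fun j => Cmult (w j) (trigpoly a d (t + x j))))).
Proof.
  (* Sampling frequencies up to [d] with a kernel of order [d] requires at least [d + d] nodes. *)
  intros Hd HM. set (Q := (2 * d)%nat).
  assert (HQ : 0 < INR Q) by (apply lt_0_INR; unfold Q; lia).
  assert (Hd' : INR d <> 0) by (apply not_0_INR; lia).
  assert (HM' : INR M <> 0) by (apply not_0_INR; lia).
  exists Q, (fun j => Cmult (RtoC (/ INR Q))
     (Cmult (cexpi (INR d * node Q j)) (RtoC (fejer d (0 - (0 + node Q j)))))),
    (fun j => - node Q j). split.
  - rewrite (Rsum_ext _ _ (fun j => / INR Q * fejer d (0 - (0 + node Q j)))).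
    + rewrite Rsum_scal, fejer_lattice_sum by (unfold Q; lia). field; lra.
    + intros j _. rewrite !Cmod_mult, Cmod_cexpi, !Cmod_R, Rmult_1_l.
      rewrite !Rabs_pos_eq; auto.
      * now apply fejer_nonneg.
      * left; now apply Rinv_0_lt_compat.
  - intros a t.
    (* The modulation turns frequency [m] into [d - m], whose Fejér multiplier is
       [1 - (d - m) / d = m / d]. *)
    rewrite (Csum_ext _ _ (fun j => Csum (S d) (fun m =>
      Cmult (Cmult (RtoC (/ INR Q)) (Cmult (a m) (cexpi (INR m * t))))
        (Cmult (cexpi (INR (d - m) * (0 + node Q j)))
           (RtoC (fejer d (0 - (0 + node Q j)))))))).
    2: { intros j _. rewrite trigpoly_Csum, <- Csum_scal.
         apply Csum_ext; intros m Hm. rewrite minus_INR by lia.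
         replace ((INR d - INR m) * (0 + node Q j))
           with (INR d * node Q j + INR m * - node Q j) by ring.
         replace (INR m * (t + - node Q j)) with (INR m * t + INR m * - node Q j)
           by ring.
         rewrite !cexpi_plus. ring. }
    rewrite Csum_switch, !trigpoly_Csum, <- Csum_scal, <- Csum_plus.
    apply Csum_ext; intros m Hm.
    rewrite Csum_scal, fejer_sampling by (unfold Q; lia).
    rewrite Rmult_0_r, cexpi_0. unfold smooth.
    replace (INR Q * (1 - INR (d - m) / INR d)) with (INR Q * (INR m / INR d))
      by (rewrite minus_INR by lia; field; auto).
    replace (RtoC (1 - INR m / INR M)) with
      (Cminus (RtoC 1) (RtoC (INR d / INR M * / INR Q * (INR Q * (INR m / INR d))))).
    + rewrite !RtoC_mult. ring.
    + rewrite <- RtoC_minus. f_equal. field. repeat split; auto; lra.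
Qed.

(** [condexpN] is itself a mean of translates and so commutes with the translates in Bernstein's
    formula. The same [Q], [w], [x] serve every [N]. *)
Lemma condexpN_smooth_translates (d M : nat) :
  (0 < d)%nat -> (0 < M)%nat ->
  exists (Q : nat) (w : nat -> C) (x : nat -> R),
    Rsum Q (fun j => Cmod (w j)) = 1 /\
    forall N a t, (0 < N)%nat -> condexpN N (trigpoly a d) t
      = Cplus (condexpN N (trigpoly (smooth M a) d) t)
          (Cmult (RtoC (INR d / INR M))
             (Csum Q (fun j => Cmult (w j) (condexpN N (trigpoly a d) (t + x j))))).
Proof.
  intros Hd HM. destruct (smooth_translates d M Hd HM) as (Q & w & x & Hw & H).
  exists Q, w, x. split; auto. intros N a t HN.
  rewrite (Csum_ext Q _ (fun j => Csum N (fun i => Cmult (RtoC (/ INR N))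
     (Cmult (w j) (trigpoly a d (t + node N i + x j)))))).
  2: { intros j _. rewrite condexpN_Csum by auto. rewrite <- !Csum_scal.
       apply Csum_ext; intros i _.
       replace (t + x j + node N i) with (t + node N i + x j) by ring. ring. }
  rewrite Csum_switch, !condexpN_Csum by auto.
  rewrite <- !Csum_scal, <- Csum_plus. apply Csum_ext; intros i _.
  rewrite (H a (t + node N i)), !Csum_scal. ring.
Qed.

(** * Euclidean norms and the convex functions [phi s] *)

(** Euclidean norm in the plane, convertible with [Cmod (a, b)]; its triangle inequality is that of
    [Cmod]. *)
Definition hyp (a b : R) : R := sqrt (a ^ 2 + b ^ 2).

Lemma hyp_sq_nonneg a b : 0 <= a ^ 2 + b ^ 2.
Proof. pose proof (pow2_ge_0 a); pose proof (pow2_ge_0 b); lra. Qed.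

Lemma hyp_triangle a b c d : hyp (a + b) (c + d) <= hyp a c + hyp b d.
Proof. exact (Cmod_triangle (a, c) (b, d)). Qed.

Lemma hyp_scal w a b : 0 <= w -> hyp (w * a) (w * b) = w * hyp a b.
Proof.
  intros Hw. unfold hyp.
  replace ((w * a) ^ 2 + (w * b) ^ 2) with (w ^ 2 * (a ^ 2 + b ^ 2)) by ring.
  rewrite sqrt_mult by (apply pow2_ge_0 || apply hyp_sq_nonneg).
  now rewrite sqrt_pow2.
Qed.

Lemma hyp_mono a b c d : 0 <= a <= c -> 0 <= b <= d -> hyp a b <= hyp c d.
Proof.
  intros Ha Hb. apply sqrt_le_1_alt.
  assert (a ^ 2 <= c ^ 2) by (apply pow_incr; lra).
  assert (b ^ 2 <= d ^ 2) by (apply pow_incr; lra). lra.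
Qed.

Lemma hyp_0_r a : 0 <= a -> hyp a 0 = a.
Proof.
  intros Ha. unfold hyp. replace (a ^ 2 + 0 ^ 2) with (a ^ 2) by ring.
  now apply sqrt_pow2.
Qed.

Lemma hyp_sqr a b : hyp a b ^ 2 = a ^ 2 + b ^ 2.
Proof. unfold hyp. rewrite pow2_sqrt; auto. apply hyp_sq_nonneg. Qed.

Lemma hyp_ge_l a b : 0 <= a -> a <= hyp a b.
Proof.
  intros Ha. rewrite <- (hyp_0_r a) at 1 by auto. unfold hyp.
  apply sqrt_le_1_alt. pose proof (pow2_ge_0 b). lra.
Qed.

Lemma hyp_ge_r a b : 0 <= b -> b <= hyp a b.
Proof.
  intros Hb. unfold hyp. rewrite Rplus_comm. now apply hyp_ge_l.
Qed.

Lemma hyp_Rsum n a b :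
  hyp (Rsum n a) (Rsum n b) <= Rsum n (fun j => hyp (a j) (b j)).
Proof.
  induction n as [|n IH]; simpl.
  - rewrite hyp_0_r; lra.
  - eapply Rle_trans; [apply hyp_triangle | lra].
Qed.

Lemma cper_hyp f g : cper f -> cper g -> cper (fun t => hyp (f t) (g t)).
Proof.
  intros. apply cper_sqrt, cper_plus; now apply cper_pow2.
Qed.

(** The increase in length when a coordinate [x] is appended to a vector of length [s]. *)
Definition phi (s x : R) : R := hyp s x - s.

Lemma phi_nonneg s x : 0 <= s -> 0 <= phi s x.
Proof. intros Hs. unfold phi. pose proof (hyp_ge_l s x Hs). lra. Qed.

(** Triangle inequality for [(s, x) + (s' - s, 0)]. *)
Lemma phi_decr s s' x : 0 <= s <= s' -> phi s' x <= phi s x.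
Proof.
  intros Hs. unfold phi. pose proof (hyp_triangle s (s' - s) x 0) as H.
  rewrite (hyp_0_r (s' - s)) in H by lra.
  replace (s + (s' - s)) with s' in H by ring. rewrite Rplus_0_r in H. lra.
Qed.

Lemma phi_mono s x y : 0 <= s -> 0 <= x <= y -> phi s x <= phi s y.
Proof.
  intros Hs Hx. unfold phi. pose proof (hyp_mono s x s y ltac:(lra) Hx). lra.
Qed.

(** Appending [x] and then [y] appends [hyp x y] in all. The second increase is measured from the
    larger length [hyp s x], so it is at most [phi s y]. *)
Lemma phi_subadd s x y : 0 <= s -> phi s (hyp x y) <= phi s x + phi s y.
Proof.
  intros Hs. pose proof (hyp_ge_l s x Hs) as H1.
  pose proof (phi_decr s (hyp s x) y ltac:(lra)) as H2. unfold phi in *.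
  replace (hyp s (hyp x y)) with (hyp (hyp s x) y); [lra|].
  unfold hyp at 1 3. f_equal. rewrite !hyp_sqr. ring.
Qed.

Lemma cper_phi s f : cper f -> cper (fun t => phi s (f t)).
Proof.
  intros H. apply cper_minus; [|apply cper_const].
  apply cper_hyp; auto; apply cper_const.
Qed.

(** Indices start at 0; the sums from 1 to [n] of the theorem therefore appear with arguments
    [S k]. *)
Definition l2 (n : nat) (v : nat -> C) : R := sqrt (Rsum n (fun i => Cmod (v i) ^ 2)).

Lemma l2_sum_nonneg n (v : nat -> C) : 0 <= Rsum n (fun i => Cmod (v i) ^ 2).
Proof. apply Rsum_nonneg; intros; apply pow2_ge_0. Qed.

Lemma l2_nonneg n v : 0 <= l2 n v.
Proof. apply sqrt_pos. Qed.

Lemma l2_S n v : l2 (S n) v = hyp (l2 n v) (Cmod (v n)).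
Proof.
  unfold l2 at 1, hyp. simpl Rsum. f_equal. f_equal. unfold l2.
  rewrite pow2_sqrt; auto. apply l2_sum_nonneg.
Qed.

(** Minkowski's inequality for a positive combination of vectors, by induction on the number of
    coordinates: each new coordinate is joined by [hyp], which is subadditive. *)
Lemma l2_minkowski n Q (w : nat -> R) (v : nat -> nat -> C) :
  (forall j, 0 <= w j) ->
  l2 n (fun i => Csum Q (fun j => Cmult (v j i) (RtoC (w j))))
  <= Rsum Q (fun j => w j * l2 n (v j)).
Proof.
  intros Hw. induction n as [|n IH].
  - unfold l2 at 1; simpl. rewrite sqrt_0. apply Rsum_nonneg; intros.
    apply Rmult_le_pos; auto. apply l2_nonneg.
  - rewrite l2_S.
    eapply Rle_trans; [apply hyp_mono; split|].
    + apply l2_nonneg.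
    + exact IH.
    + apply Cmod_ge_0.
    + apply Cmod_Csum.
    + eapply Rle_trans; [apply hyp_Rsum|]. apply Rsum_le; intros j _.
      rewrite Cmod_mult, Cmod_R, Rabs_pos_eq, (Rmult_comm (Cmod _)) by auto.
      rewrite hyp_scal, l2_S by auto. lra.
Qed.

Lemma l2_scal n c v :
  0 <= c -> l2 n (fun i => Cmult (RtoC c) (v i)) = c * l2 n v.
Proof.
  intros Hc. induction n as [|n IH].
  - unfold l2; simpl. rewrite sqrt_0; ring.
  - rewrite !l2_S, IH, Cmod_mult, Cmod_R, Rabs_pos_eq by auto. now apply hyp_scal.
Qed.

Lemma cper_l2 n (f : nat -> R -> C) :
  (forall i, ccper (f i)) -> cper (fun t => l2 n (fun i => f i t)).
Proof.
  intros H. apply cper_sqrt, (cper_sum n (fun i t => Cmod (f i t) ^ 2)).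
  intros. now apply cper_pow2, cper_Cmod.
Qed.

(** * From (i) to (ii) and (iii) *)

(* With [X] and [Y] the two sides, convexity of [phi s] gives
   [X <= (1 - delta) Y + delta X]. *)
Lemma torus_E_phi_unsmooth s delta c (h h' : R -> C) Q (w : nat -> C) (x : nat -> R) :
  0 <= s -> 0 <= delta < 1 -> 0 <= c -> ccper h -> ccper h' ->
  Rsum Q (fun j => Cmod (w j)) = 1 ->
  (forall t, h t = Cplus (h' t)
     (Cmult (RtoC delta) (Csum Q (fun j => Cmult (w j) (h (t + x j)))))) ->
  torus_E (fun t => phi s (c * (1 - delta) * Cmod (h t)))
  <= torus_E (fun t => phi s (c * Cmod (h' t))).
Proof.
  intros Hs Hd Hc Hh Hh' Hw Hrel.
  set (k := c * (1 - delta)).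
  assert (Hk : 0 <= k) by (apply Rmult_le_pos; lra).
  assert (HpX : cper (fun t => phi s (k * Cmod (h t)))).
  { apply cper_phi, cper_mult; [apply cper_const | now apply cper_Cmod]. }
  assert (HpY : cper (fun t => phi s (c * Cmod (h' t)))).
  { apply cper_phi, cper_mult; [apply cper_const | now apply cper_Cmod]. }
  assert (Hpt : forall t, phi s (k * Cmod (h t))
     <= (1 - delta) * phi s (c * Cmod (h' t))
        + delta * Rsum Q (fun j => Cmod (w j) * phi s (k * Cmod (h (t + x j))))).
  { intros t. set (b := Rsum Q (fun j => Cmod (w j) * (k * Cmod (h (t + x j))))).
    (* Triangle inequality in the relation between [h] and [h']. The factor [1 - delta] inside [k]
       comes out in front of [h'], while the translates of [h] keep the factor [k]. *)
    assert (Hb : k * Cmod (h t) <= (1 - delta) * (c * Cmod (h' t)) + delta * b).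
    { rewrite Hrel.
      assert (H1 : Cmod (Cmult (RtoC delta)
                     (Csum Q (fun j => Cmult (w j) (h (t + x j)))))
                   <= delta * Rsum Q (fun j => Cmod (w j) * Cmod (h (t + x j)))).
      { rewrite Cmod_mult, Cmod_R, Rabs_pos_eq by lra.
        apply Rmult_le_compat_l; [lra|].
        eapply Rle_trans; [apply Cmod_Csum|]. right.
        apply Rsum_ext; intros; apply Cmod_mult. }
      assert (H2 : b = k * Rsum Q (fun j => Cmod (w j) * Cmod (h (t + x j)))).
      { unfold b. rewrite <- Rsum_scal. apply Rsum_ext; intros; ring. }
      rewrite H2.
      eapply Rle_trans; [apply Rmult_le_compat_l, Cmod_triangle; auto|].
      apply Rle_trans with (k * (Cmod (h' t) + delta *
        Rsum Q (fun j => Cmod (w j) * Cmod (h (t + x j))))).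
      - apply Rmult_le_compat_l; lra.
      - unfold k. right; ring. }
    assert (Hsum : Rsum Q (fun j => Cmod (w j) * phi s (k * Cmod (h (t + x j))))
              = Rsum Q (fun j => Cmod (w j) * hyp s (k * Cmod (h (t + x j)))) - s).
    { transitivity (Rsum Q (fun j => Cmod (w j) * hyp s (k * Cmod (h (t + x j)))
                                     + - s * Cmod (w j))).
      - apply Rsum_ext; intros; unfold phi; ring.
      - rewrite Rsum_plus, Rsum_scal, Hw. ring. }
    rewrite Hsum.
    (* Jensen's inequality: the weights [Cmod (w j)] sum to 1, so [s] is itself a weighted mean and
       the triangle inequality for [hyp] applies. *)
    assert (Hhyp : hyp s b
              <= Rsum Q (fun j => Cmod (w j) * hyp s (k * Cmod (h (t + x j))))).
    { replace (hyp s b) with (hyp (Rsum Q (fun j => Cmod (w j) * s)) b).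
      - unfold b. eapply Rle_trans; [apply hyp_Rsum|]. right.
        apply Rsum_ext; intros. apply hyp_scal, Cmod_ge_0.
      - f_equal. rewrite (Rsum_ext _ _ (fun j => s * Cmod (w j))) by (intros; ring).
        rewrite Rsum_scal, Hw; ring. }
    assert (H3 : hyp s (k * Cmod (h t))
              <= (1 - delta) * hyp s (c * Cmod (h' t)) + delta * hyp s b).
    { rewrite <- !hyp_scal by lra.
      eapply Rle_trans; [|apply hyp_triangle].
      replace ((1 - delta) * s + delta * s) with s by ring.
      apply hyp_mono; [lra|]. split; auto.
      apply Rmult_le_pos; auto; apply Cmod_ge_0. }
    assert (H4 : delta * hyp s b <= delta *
              Rsum Q (fun j => Cmod (w j) * hyp s (k * Cmod (h (t + x j)))))
      by (apply Rmult_le_compat_l; lra).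
    unfold phi. nra. }
  set (X := torus_E (fun t => phi s (k * Cmod (h t)))) in *.
  assert (HpS : forall j, cper (fun t => Cmod (w j) * phi s (k * Cmod (h (t + x j))))).
  { intros j. apply cper_mult; [apply cper_const|].
    exact (cper_shift _ (x j) HpX). }
  (* All translates have the same integral [X], and the term [delta * X] is absorbed on the left
     since [delta < 1]. *)
  assert (HE : X <= (1 - delta) * torus_E (fun t => phi s (c * Cmod (h' t)))
                    + delta * X).
  { assert (HR : torus_E (fun t => Rsum Q (fun j =>
                   Cmod (w j) * phi s (k * Cmod (h (t + x j))))) = X).
    { rewrite (torus_E_sum Q (fun j t => Cmod (w j) * phi s (k * Cmod (h (t + x j)))))
        by auto.
      rewrite (Rsum_ext _ _ (fun j => X * Cmod (w j))).
      - rewrite Rsum_scal, Hw; ring.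
      - intros j _. rewrite torus_E_scal by exact (cper_shift _ (x j) HpX).
        rewrite Rmult_comm. f_equal. exact (torus_E_shift _ (x j) HpX). }
    rewrite <- HR at 2. rewrite <- !torus_E_scal; auto.
    2: { apply (cper_sum Q (fun j t => Cmod (w j) * phi s (k * Cmod (h (t + x j))))).
         auto. }
    rewrite <- torus_E_plus.
    - apply torus_E_le; auto.
      apply cper_plus; (apply cper_mult; [apply cper_const|]); auto.
      apply (cper_sum Q (fun j t => Cmod (w j) * phi s (k * Cmod (h (t + x j))))); auto.
    - apply cper_mult; [apply cper_const|]; auto.
    - apply cper_mult; [apply cper_const|].
      apply (cper_sum Q (fun j t => Cmod (w j) * phi s (k * Cmod (h (t + x j))))); auto. }
  apply Rmult_le_reg_l with (1 - delta); lra.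
Qed.

(** The quantity called [s] in the telescoping argument. *)
Definition l2_mean (d : nat -> nat) (a : nat -> nat -> C) (n : nat) : R :=
  torus_E (fun t => l2 n (fun i => trigpoly (a i) (d i) t)).

Lemma cper_l2_trigpoly d (a : nat -> nat -> C) n :
  cper (fun t => l2 n (fun i => trigpoly (a i) (d i) t)).
Proof. apply (cper_l2 n (fun i => trigpoly (a i) (d i))). intros; apply ccper_trigpoly. Qed.

Lemma l2_mean_nonneg d a n : 0 <= l2_mean d a n.
Proof.
  apply torus_E_ge_const; [apply cper_l2_trigpoly | intros; apply l2_nonneg].
Qed.

(** At each [u] the vector of smoothed values is the Fejér-weighted mean of the sampled vectors.
    Minkowski's inequality and integration in [u], where the kernel has mean 1, give a bound valid
    at every [t]. *)
Lemma l2_mean_lattice d (a : nat -> nat -> C) n N M t :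
  (0 < M)%nat -> (forall i, (i < n)%nat -> (d i <= M)%nat /\ (M + d i <= N)%nat) ->
  (M <= N)%nat ->
  l2_mean d (fun i => smooth M (a i)) n
  <= / INR N * Rsum N (fun j => l2 n (fun i => trigpoly (a i) (d i) (t + node N j))).
Proof.
  intros HM Hd HMN.
  assert (HN : 0 < INR N) by (apply lt_0_INR; lia).
  set (v := fun j i => trigpoly (a i) (d i) (t + node N j)).
  assert (Hshift : forall j, cper (fun u => fejer M (u - (t + node N j))))
    by (intros j; apply (cper_shift _ (- (t + node N j))), cper_fejer).
  assert (Hp : forall j, cper (fun u => fejer M (u - (t + node N j)) * l2 n (v j)))
    by (intros j; apply cper_mult; [auto | apply cper_const]).
  apply Rmult_le_reg_l with (INR N); auto.
  rewrite <- Rmult_assoc, Rinv_r, Rmult_1_l by lra.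
  unfold l2_mean. rewrite <- torus_E_scal by apply cper_l2_trigpoly.
  apply Rle_trans with (torus_E (fun u =>
     Rsum N (fun j => fejer M (u - (t + node N j)) * l2 n (v j)))).
  - apply torus_E_le.
    + apply cper_mult; [apply cper_const | apply cper_l2_trigpoly].
    + apply (cper_sum N (fun j u => fejer M (u - (t + node N j)) * l2 n (v j))). auto.
    + intros u. rewrite <- l2_scal by lra.
      eapply Rle_trans;
        [|apply (l2_minkowski n N (fun j => fejer M (u - (t + node N j))) v)].
      * right. unfold l2. f_equal. apply Rsum_ext; intros i Hi.
        destruct (Hd i Hi). unfold v.
        now rewrite trigpoly_sampling by lia.
      * intros; now apply fejer_nonneg.
  - rewrite (torus_E_sum N (fun j u => fejer M (u - (t + node N j)) * l2 n (v j))) by auto.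
    right. apply Rsum_ext; intros j _.
    rewrite (torus_E_ext _ (fun u => l2 n (v j) * fejer M (u - (t + node N j))))
      by (intros; ring).
    rewrite torus_E_scal by auto.
    replace (torus_E (fun u => fejer M (u - (t + node N j)))) with 1; [unfold v; ring|].
    rewrite <- (torus_E_fejer M) by auto. symmetry.
    apply (torus_E_shift (fejer M) (- (t + node N j))), cper_fejer.
Qed.

(** The mean of the norm is first replaced by its average over the lattice of order [N]. There
    [hyp_Rsum] moves the average inside both coordinates: the first is then bounded below by the
    smoothed mean of the earlier functions, the second by the modulus of the conditional
    expectation. *)
Lemma l2_mean_step d (a : nat -> nat -> C) n N M :
  (0 < M)%nat -> (forall i, (i < n)%nat -> (d i <= M)%nat /\ (M + d i <= N)%nat) ->
  (M <= N)%nat ->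
  torus_E (fun t => hyp (l2_mean d (fun i => smooth M (a i)) n)
                      (Cmod (condexpN N (trigpoly (a n) (d n)) t)))
  <= l2_mean d a (S n).
Proof.
  intros HM Hd HMN.
  assert (HN : (0 < N)%nat) by lia.
  assert (HN' : 0 < INR N) by (now apply lt_0_INR).
  assert (HiN : 0 < / INR N) by (now apply Rinv_0_lt_compat).
  set (g := fun t => l2 (S n) (fun i => trigpoly (a i) (d i) t)).
  assert (Hg : cper g) by apply cper_l2_trigpoly.
  assert (HE : torus_E (fun t => / INR N * Rsum N (fun j => g (t + node N j)))
               = l2_mean d a (S n)).
  { rewrite torus_E_scal.
    2: { apply (cper_sum N (fun j t => g (t + node N j))).
         intros; now apply cper_shift. }
    rewrite (torus_E_sum N (fun j t => g (t + node N j)))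
      by (intros; now apply cper_shift).
    rewrite (Rsum_ext _ _ (fun _ => torus_E g))
      by (intros; now apply torus_E_shift).
    rewrite Rsum_const. unfold l2_mean. fold g. field; lra. }
  rewrite <- HE. apply torus_E_le.
  - apply cper_hyp; [apply cper_const|].
    apply cper_Cmod, ccper_condexpN; auto. apply ccper_trigpoly.
  - apply cper_mult; [apply cper_const|].
    apply (cper_sum N (fun j t => g (t + node N j))). intros; now apply cper_shift.
  - intros t.
    rewrite (Rsum_ext _ _ (fun j => hyp
       (l2 n (fun i => trigpoly (a i) (d i) (t + node N j)))
       (Cmod (trigpoly (a n) (d n) (t + node N j)))))
      by (intros; unfold g; apply l2_S).
    eapply Rle_trans; [|apply Rmult_le_compat_l, hyp_Rsum; lra].
    rewrite <- hyp_scal by lra. apply hyp_mono; split.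
    + apply l2_mean_nonneg.
    + now apply l2_mean_lattice.
    + apply Cmod_ge_0.
    + rewrite condexpN_Csum, Cmod_mult, Cmod_R, Rabs_pos_eq by (auto; lra).
      apply Rmult_le_compat_l; [lra | apply Cmod_Csum].
Qed.

Lemma half_pow_bounds j : 0 < (1 / 2) ^ j <= 1.
Proof. induction j as [|j IH]; simpl; lra. Qed.

(** The constants [1 / 2 + (1 / 2) ^ j] start at 1 for [j = 1] and stay above [1 / 2], yet decrease
    fast enough to absorb the factor lost at each smoothing. *)
Lemma unsmooth_constant j :
  (1 <= j)%nat ->
  1 / 2 + (1 / 2) ^ S j <= (1 / 2 + (1 / 2) ^ j) * (1 - (1 / 2) ^ S j).
Proof.
  intros Hj. destruct j as [|j]; [lia|]. simpl.
  pose proof (half_pow_bounds j).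
  nra.
Qed.

(** Induction on [n] over all families of coefficients, because the averaging step replaces [a] by a
    smoothed family. The separation hypotheses exclude aliasing in that step and make the successive
    losses for each polynomial summable. *)
Lemma torus_E_phi_sum_le (d N M : nat -> nat) :
  (forall i, (0 < d i)%nat) -> (forall k, (0 < M k <= N k)%nat) ->
  (forall i k, (i < k)%nat -> (M k + d i <= N k)%nat) ->
  (forall i k, (i < k)%nat -> INR (d i) / INR (M k) <= (1 / 2) ^ S (k - i)) ->
  forall n (a : nat -> nat -> C),
  Rsum n (fun i => torus_E (fun t => phi (l2_mean d a n)
     ((1 / 2 + (1 / 2) ^ (n - i)) * Cmod (condexpN (N i) (trigpoly (a i) (d i)) t))))
  <= l2_mean d a n.
Proof.
  intros Hd HM HMd Hr.
  assert (Hc : forall i b, ccper (condexpN (N i) (trigpoly b (d i)))).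
  { intros i b. apply ccper_condexpN; [specialize (HM i); lia | apply ccper_trigpoly]. }
  assert (Hp : forall s c i b,
     cper (fun t => phi s (c * Cmod (condexpN (N i) (trigpoly b (d i)) t)))).
  { intros. apply cper_phi, cper_mult; [apply cper_const | now apply cper_Cmod]. }
  assert (HdM : forall i k, (i < k)%nat -> (d i <= M k)%nat).
  { intros i k Hik. apply INR_le. pose proof (Hr i k Hik) as H.
    assert (0 < INR (M k)) by (apply lt_0_INR; apply HM).
    pose proof (half_pow_bounds (S (k - i))).
    replace (INR (d i)) with (INR (d i) / INR (M k) * INR (M k)) by (field; lra).
    apply Rle_trans with (1 * INR (M k)); [|lra]. apply Rmult_le_compat_r; lra. }
  induction n as [|n IH]; intros a; [simpl; apply l2_mean_nonneg|].
  set (a' := fun i => smooth (M n) (a i)).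
  set (s := l2_mean d a (S n)). set (s' := l2_mean d a' n).
  assert (Hs' : 0 <= s') by apply l2_mean_nonneg.
  assert (Hstep : torus_E (fun t => hyp s'
                    (Cmod (condexpN (N n) (trigpoly (a n) (d n)) t))) <= s).
  { apply l2_mean_step; try apply HM. intros i Hi; split; auto. }
  assert (Hmono : s' <= s).
  { eapply Rle_trans; [|exact Hstep]. apply torus_E_ge_const.
    - apply cper_hyp; [apply cper_const | apply cper_Cmod; auto].
    - intros; now apply hyp_ge_l. }
  (* The newest term carries the constant 1. Lowering the base from [s] to [s'] bounds it by the
     gain [s - s'] of the averaging step, which makes the sum telescope. *)
  assert (Hlast : torus_E (fun t => phi s ((1 / 2 + (1 / 2) ^ (S n - n))
       * Cmod (condexpN (N n) (trigpoly (a n) (d n)) t))) <= s - s').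
  { apply Rle_trans with (torus_E (fun t =>
      hyp s' (Cmod (condexpN (N n) (trigpoly (a n) (d n)) t)) - s')).
    - apply torus_E_le; auto.
      + apply cper_minus; [|apply cper_const].
        apply cper_hyp; [apply cper_const | apply cper_Cmod; auto].
      + intros t. replace (S n - n)%nat with 1%nat by lia.
        replace ((1 / 2 + (1 / 2) ^ 1)) with 1 by (simpl; field). rewrite Rmult_1_l.
        apply (phi_decr s' s); lra.
    - rewrite torus_E_minus, torus_E_const; try lra.
      + apply cper_hyp; [apply cper_const | apply cper_Cmod; auto].
      + apply cper_const. }
  cbn [Rsum].
  apply Rle_trans with (s' + (s - s')); [|lra].
  apply Rplus_le_compat; [|exact Hlast].
  (* The earlier terms are compared with those of the smoothed family, whose total is at most [s'];
     Bernstein's inequality undoes the smoothing at the cost of [1 - delta]. *)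
  eapply Rle_trans; [|exact (IH a')]. fold s'.
  apply Rsum_le; intros i Hi.
  set (delta := INR (d i) / INR (M n)).
  assert (HMn : 0 < INR (M n)) by (apply lt_0_INR; apply HM).
  assert (Hdi : 0 <= INR (d i)) by apply pos_INR.
  assert (Hdel : 0 <= delta <= (1 / 2) ^ S (n - i)).
  { split; [|now apply Hr]. apply Rmult_le_pos; auto.
    left; now apply Rinv_0_lt_compat. }
  pose proof (half_pow_bounds (n - i)) as Hpow.
  assert (Hdel1 : delta < 1) by (rewrite <- tech_pow_Rmult in Hdel; lra).
  destruct (condexpN_smooth_translates (d i) (M n) (Hd i) (proj1 (HM n)))
    as (Q & w & x & Hw & Hrel).
  eapply Rle_trans; [|apply (torus_E_phi_unsmooth s' delta (1 / 2 + (1 / 2) ^ (n - i))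
     (condexpN (N i) (trigpoly (a i) (d i)))
     (condexpN (N i) (trigpoly (a' i) (d i))) Q w x); auto; try lra].
  - apply torus_E_le; auto. intros t.
    eapply Rle_trans; [apply (phi_decr s' s); lra|].
    apply phi_mono; auto. split.
    + apply Rmult_le_pos; [|apply Cmod_ge_0].
      pose proof (half_pow_bounds (S n - i)). lra.
    + apply Rmult_le_compat_r; [apply Cmod_ge_0|].
      replace (S n - i)%nat with (S (n - i)) by lia.
      eapply Rle_trans; [apply unsmooth_constant; lia|].
      apply Rmult_le_compat_l; lra.
  - intros t. apply Hrel. specialize (HM i). lia.
Qed.

(** * Splitting the indices into residue classes *)

(** A proper multiple of a positive integer is at least its double, and [N k = 0] would force
    [N (S k) = 0]. *)
Lemma growth_pow2 (N : nat -> nat) :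
  (forall k, (1 <= k)%nat -> Nat.divide (N k) (N (S k))) ->
  (forall k, (1 <= k)%nat -> (N k < N (S k))%nat) ->
  forall k, (1 <= k)%nat ->
  (0 < N k)%nat /\ forall b, (2 ^ b * N k <= N (k + b))%nat.
Proof.
  intros Hdiv Hlt k Hk.
  assert (Hpos : forall k, (1 <= k)%nat -> (0 < N k)%nat).
  { intros i Hi. destruct (Nat.eq_dec (N i) 0) as [H0|]; [|lia].
    destruct (Hdiv i Hi) as [q Hq]. specialize (Hlt i Hi). nia. }
  split; auto. induction b as [|b IH].
  - rewrite Nat.add_0_r; simpl; lia.
  - replace (k + S b)%nat with (S (k + b)) by lia.
    destruct (Hdiv (k + b)%nat ltac:(lia)) as [q Hq].
    specialize (Hlt (k + b)%nat ltac:(lia)).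
    assert (2 <= q)%nat by nia. simpl (2 ^ S b)%nat. nia.
Qed.

(** Homogeneity. It trades the factor [1 / 2], a lower bound for all the constants above, for the
    base [2 * s]. *)
Lemma phi_double s x : phi (2 * s) x = 2 * phi s (1 / 2 * x).
Proof.
  unfold phi. replace x with (2 * (1 / 2 * x)) at 1 by field.
  rewrite hyp_scal by lra. ring.
Qed.

Lemma phi_l2 s n v : 0 <= s -> phi s (l2 n v) <= Rsum n (fun i => phi s (Cmod (v i))).
Proof.
  intros Hs. induction n as [|n IH].
  - unfold l2, phi; simpl. rewrite sqrt_0, hyp_0_r; lra.
  - rewrite l2_S. simpl Rsum. eapply Rle_trans; [now apply phi_subadd | lra].
Qed.

Lemma trigpoly_zero d t : trigpoly (fun _ => RtoC 0) d t = RtoC 0.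
Proof.
  rewrite trigpoly_Csum, (Csum_ext _ _ (fun _ => RtoC 0)) by (intros; ring).
  apply Csum_0.
Qed.

Lemma Rsum_vanish n K x :
  (n <= K)%nat -> (forall k, (n <= k)%nat -> x k = 0) -> Rsum K x = Rsum n x.
Proof.
  intros HK Hx. replace K with (n + (K - n))%nat by lia. rewrite Rsum_add.
  rewrite (Rsum_ext (K - n) _ (fun _ => 0)) by (intros; apply Hx; lia).
  rewrite Rsum_const. ring.
Qed.

(** From [x + a] to [x + j * (a + S b)] there are at least [b + j] doublings: [2 ^ b] absorbs
    [16 * C0], and [2 ^ j] remains. *)
Lemma class_separation (d N : nat -> nat) (a b : nat) (C0 : R) :
  (forall k, (1 <= k)%nat -> (0 < N k)%nat /\ forall b, (2 ^ b * N k <= N (k + b))%nat) ->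
  (forall k, (1 <= k)%nat -> INR (d k) <= C0 * INR (N (k + a)%nat)) ->
  16 * C0 <= 2 ^ b ->
  forall x j, (1 <= x)%nat -> (1 <= j)%nat ->
  (16 * 2 ^ j * d x <= N (x + j * (a + S b)))%nat.
Proof.
  intros HN Hi HC x j Hx Hj.
  destruct (HN (x + a)%nat ltac:(lia)) as [Hpos Hgr].
  specialize (Hgr (j * (a + S b) - a)%nat).
  replace (x + a + (j * (a + S b) - a))%nat with (x + j * (a + S b))%nat in Hgr by nia.
  assert (Hexp : (2 ^ (b + j) <= 2 ^ (j * (a + S b) - a))%nat)
    by (apply Nat.pow_le_mono_r; nia).
  assert (H1 : (2 ^ (b + j) * N (x + a) <= N (x + j * (a + S b)))%nat) by nia.
  apply INR_le. apply le_INR in H1.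
  rewrite mult_INR, pow_INR in H1.
  rewrite !mult_INR, pow_INR.
  replace (INR 2) with 2 in * by (simpl; ring).
  replace (INR 16) with 16 by (simpl; ring).
  rewrite pow_add in H1.
  specialize (Hi x Hx).
  assert (H2j : 0 < 2 ^ j) by (apply pow_lt; lra).
  assert (HNp : 0 < INR (N (x + a)%nat)) by (now apply lt_0_INR).
  assert (H3 : 16 * INR (d x) <= 2 ^ b * INR (N (x + a)%nat)) by nra.
  nra.
Qed.

(** Within a residue class modulo [m] the degrees are separated from later periods, so the
    telescoping bound applies; the [m] classes are then added. *)
Lemma torus_E_phi_bound (d N : nat -> nat) (a : nat) (C0 : R) :
  (forall k, (1 <= k)%nat -> (0 < d k)%nat) ->
  (forall k, (1 <= k)%nat -> (0 < N k)%nat /\ forall b, (2 ^ b * N k <= N (k + b))%nat) ->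
  (forall k, (1 <= k)%nat -> INR (d k) <= C0 * INR (N (k + a)%nat)) ->
  exists m : nat, forall n (coef : nat -> nat -> C),
    let s := torus_E (fun t => l2 n (fun k => trigpoly (coef (S k)) (d (S k)) t)) in
    Rsum n (fun k => torus_E (fun t => phi (2 * s)
        (Cmod (condexpN (N (S k)) (trigpoly (coef (S k)) (d (S k))) t))))
    <= 2 * INR m * s.
Proof.
  intros Hd HN Hi.
  destruct (INR_unbounded (16 * C0)) as [b Hb].
  assert (HC : 16 * C0 <= 2 ^ b).
  { assert (INR b <= 2 ^ b).
    { clear. replace 2 with (INR 2) by (simpl; ring). rewrite <- pow_INR.
      apply le_INR. pose proof (Nat.pow_gt_lin_r 2 b). lia. }
    lra. }
  set (m := (a + S b)%nat). exists m. intros n coef s.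
  assert (Hsep : forall x j, (1 <= x)%nat -> (1 <= j)%nat ->
            (16 * 2 ^ j * d x <= N (x + j * m))%nat)
    by exact (class_separation d N a b C0 HN Hi HC).
  assert (Hm : (1 <= m)%nat) by (unfold m; lia).
  (* Padding by zero beyond [n] lets every class have exactly [n] terms. *)
  set (coef' := fun k => if le_dec k n then coef k else fun _ => RtoC 0).
  assert (Hs : 0 <= s).
  { apply torus_E_ge_const; [apply (cper_l2_trigpoly (fun k => d (S k)) (fun k => coef (S k)))
    | intros; apply l2_nonneg]. }
  assert (Hc : forall i c, ccper (condexpN (N (S i)) (trigpoly c (d (S i))))).
  { intros. apply ccper_condexpN; [apply HN; lia | apply ccper_trigpoly]. }
  assert (Hp : forall s c i b,
     cper (fun t => phi s (c * Cmod (condexpN (N (S i)) (trigpoly b (d (S i))) t)))).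
  { intros. apply cper_phi, cper_mult; [apply cper_const | now apply cper_Cmod]. }
  set (psi := fun k => torus_E (fun t => phi s (1 / 2 *
        Cmod (condexpN (N (S k)) (trigpoly (coef' (S k)) (d (S k))) t)))).
  assert (Hpsi : forall k, 0 <= psi k).
  { intros k. apply torus_E_ge_const; auto. intros; now apply phi_nonneg. }
  assert (Hclass : forall r, (r < m)%nat -> Rsum n (fun i => psi (i * m + r)%nat) <= s).
  { intros r Hr.
    set (dr := fun i => d (S (i * m + r))). set (Nr := fun i => N (S (i * m + r))).
    (* A kernel order that leaves a quarter of [N] for the degrees, up to rounding, and is still at
       least half of [N]. *)
    set (Mr := fun i => (Nr i - Nr i / 4)%nat).
    set (ar := fun i => coef' (S (i * m + r))).
    assert (HNr : forall i, (0 < Nr i)%nat) by (intros i; apply HN; lia).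
    assert (HMr : forall i, (0 < Mr i <= Nr i)%nat /\ (2 * Mr i >= Nr i)%nat).
    { intros i. unfold Mr. specialize (HNr i).
      pose proof (Nat.div_mod_eq (Nr i) 4).
      lia. }
    assert (Hsep' : forall i k, (i < k)%nat -> (16 * 2 ^ (k - i) * dr i <= Nr k)%nat).
    { intros i k Hik. unfold Nr.
      replace (S (k * m + r)) with (S (i * m + r) + (k - i) * m)%nat.
      - apply Hsep; lia.
      - replace k with (i + (k - i))%nat at 2 by lia. nia. }
    (* A class is a subfamily of the padded family, so its square function is pointwise smaller. *)
    assert (Hsr : l2_mean dr ar n <= s).
    { apply torus_E_le;
        [apply cper_l2_trigpoly
        |apply (cper_l2_trigpoly (fun k => d (S k)) (fun k => coef (S k)))|].
      intros t. apply sqrt_le_1_alt.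
      set (x := fun k => Cmod (trigpoly (coef' (S k)) (d (S k)) t) ^ 2).
      assert (Hx : forall k, 0 <= x k) by (intros; apply pow2_ge_0).
      rewrite (Rsum_ext n (fun k => Cmod (trigpoly (coef (S k)) (d (S k)) t) ^ 2) x).
      2: { intros k Hk. unfold x, coef'. destruct (le_dec (S k) n); [auto | lia]. }
      rewrite <- (Rsum_vanish n (n * m) x).
      - rewrite Rsum_blocks. apply Rsum_le; intros i _.
        apply (Rsum_ge_term m (fun r => x (i * m + r)%nat)); auto.
      - nia.
      - intros k Hk. unfold x, coef'. destruct (le_dec (S k) n); [lia|].
        rewrite trigpoly_zero, Cmod_0. ring. }
    pose proof (l2_mean_nonneg dr ar n) as Hs0.
    eapply Rle_trans; [|exact Hsr].
    eapply Rle_trans; [|apply (torus_E_phi_sum_le dr Nr Mr)].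
    - apply Rsum_le; intros i Hin. apply torus_E_le; try apply Hp.
      intros t. eapply Rle_trans; [apply phi_decr; split; [exact Hs0 | exact Hsr]|].
      pose proof (Cmod_ge_0 (condexpN (Nr i) (trigpoly (ar i) (dr i)) t)) as H0.
      apply phi_mono; auto. split.
      + apply Rmult_le_pos; [lra | exact H0].
      + apply Rmult_le_compat_r; [exact H0|].
        pose proof (half_pow_bounds (n - i)). lra.
    - intros; apply Hd; lia.
    - intros; apply HMr.
    - intros i k Hik. specialize (Hsep' i k Hik).
      assert (1 <= 2 ^ (k - i))%nat by (apply Nat.neq_0_lt_0, Nat.pow_nonzero; lia).
      unfold Mr. pose proof (Nat.div_mod_eq (Nr k) 4).
      pose proof (Nat.mod_upper_bound (Nr k) 4). nia.
    - intros i k Hik. specialize (Hsep' i k Hik). destruct (HMr k) as [HM1 HM2].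
      assert (Hq : (2 ^ S (k - i) * dr i <= Mr k)%nat) by (simpl; nia).
      apply le_INR in Hq. rewrite mult_INR, pow_INR in Hq.
      assert (HMp : 0 < INR (Mr k)) by (apply lt_0_INR; lia).
      replace (INR 2) with 2 in Hq by (simpl; ring).
      assert (H2 : 0 < 2 ^ S (k - i)) by (apply pow_lt; lra).
      apply Rmult_le_reg_r with (INR (Mr k)); auto.
      unfold Rdiv. rewrite Rmult_assoc, Rinv_l, Rmult_1_r by lra.
      apply Rmult_le_reg_l with (2 ^ S (k - i)); auto.
      rewrite Rmult_1_l, <- Rmult_assoc, <- Rpow_mult_distr, Rinv_r, pow1 by lra. lra. }
  rewrite (Rsum_ext _ _ (fun k => 2 * psi k)).
  2: { intros k Hk. unfold psi. rewrite <- torus_E_scal by apply Hp.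
       apply torus_E_ext; intros t. rewrite phi_double. unfold coef'.
       destruct (le_dec (S k) n); [auto | lia]. }
  rewrite Rsum_scal.
  (* The sum is extended to [n * m] indices and regrouped by residue. *)
  assert (Hall : Rsum n psi <= INR m * s).
  { apply Rle_trans with (Rsum (n * m) psi).
    - apply Rsum_mono; auto; nia.
    - rewrite Rsum_blocks, Rsum_switch, <- Rsum_const.
      apply Rsum_le; auto. }
  lra.
Qed.

(** * The norm of independent copies *)

Lemma sqrt_plus_le x y : 0 <= x -> 0 <= y -> sqrt (x + y) <= sqrt x + sqrt y.
Proof.
  intros Hx Hy. pose proof (hyp_triangle (sqrt x) 0 0 (sqrt y)) as H.
  rewrite Rplus_0_l, Rplus_0_r in H. unfold hyp in H.
  rewrite !pow2_sqrt in H by auto.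
  replace (x + 0 ^ 2) with x in H by ring. replace (0 ^ 2 + y) with y in H by ring.
  exact H.
Qed.

(** This modulus of continuity is uniform on the whole line, negative arguments included since
    [sqrt] vanishes there. *)
Lemma sqrt_holder a b : Rabs (sqrt a - sqrt b) <= sqrt (Rabs (a - b)).
Proof.
  assert (H : forall a b, sqrt a <= sqrt b + sqrt (Rabs (a - b))).
  { intros x y. destruct (Rle_or_lt 0 y) as [Hy|Hy].
    - eapply Rle_trans; [|apply sqrt_plus_le; auto; apply Rabs_pos].
      apply sqrt_le_1_alt. pose proof (Rle_abs (x - y)). lra.
    - rewrite (sqrt_neg_0 y) by lra. rewrite Rplus_0_l. apply sqrt_le_1_alt.
      pose proof (Rle_abs (x - y)). lra. }
  pose proof (H a b) as H1. pose proof (H b a) as H2. rewrite Rabs_minus_sym in H2.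
  apply Rabs_le. lra.
Qed.

Lemma continuous_holder (F : R -> R) :
  (forall a b, Rabs (F a - F b) <= sqrt (Rabs (a - b))) ->
  forall x, continuous F x.
Proof.
  intros H x. apply continuity_pt_filterlim. intros eps Heps.
  exists (eps ^ 2). split; [apply pow_lt; lra|].
  intros y [_ Hy]. unfold dist in *; simpl in *; unfold R_dist in *.
  eapply Rle_lt_trans; [apply H|].
  rewrite <- (sqrt_pow2 eps) by lra. apply sqrt_lt_1_alt.
  split; [apply Rabs_pos | simpl; lra].
Qed.

(** The modulus of [sqrt] passes through every level of the recursion: both accumulators grow by the
    same amount, and averaging does not enlarge differences. It yields the continuity needed for the
    iterated integrals. *)
Lemma ind_aux_holder (g : nat -> R -> C) ks :
  (forall k, In k ks -> ccper (g k)) ->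
  forall a b, Rabs (ind_aux g ks a - ind_aux g ks b) <= sqrt (Rabs (a - b)).
Proof.
  induction ks as [|k ks IH]; intros Hg a b; simpl; [apply sqrt_holder|].
  assert (IH' := IH (fun i Hi => Hg i (or_intror Hi))).
  assert (Hp : forall c, cper (fun t => ind_aux g ks (c + Cmod (g k t) ^ 2))).
  { intros c. apply (cper_comp (ind_aux g ks)); [now apply continuous_holder|].
    apply cper_plus; [apply cper_const|].
    apply cper_pow2, cper_Cmod, Hg. now left. }
  assert (H : forall a b, torus_E (fun t => ind_aux g ks (a + Cmod (g k t) ^ 2))
     <= torus_E (fun t => ind_aux g ks (b + Cmod (g k t) ^ 2)) + sqrt (Rabs (a - b))).
  { intros x y. rewrite <- (torus_E_const (sqrt (Rabs (x - y)))).
    rewrite <- torus_E_plus; auto; [|apply cper_const].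
    apply torus_E_le; auto.
    - apply cper_plus; auto; apply cper_const.
    - intros t. specialize (IH' (x + Cmod (g k t) ^ 2) (y + Cmod (g k t) ^ 2)).
      replace (x + Cmod (g k t) ^ 2 - (y + Cmod (g k t) ^ 2)) with (x - y) in IH' by ring.
      apply Rabs_le_between in IH'. lra. }
  pose proof (H a b) as H1. pose proof (H b a) as H2. rewrite Rabs_minus_sym in H2.
  apply Rabs_le. simpl in H1, H2. lra.
Qed.

Lemma cper_ind_aux (g : nat -> R -> C) ks (f : R -> R) :
  (forall k, In k ks -> ccper (g k)) -> cper f -> cper (fun t => ind_aux g ks (f t)).
Proof.
  intros Hg Hf. apply (cper_comp (ind_aux g ks)); auto.
  apply continuous_holder, ind_aux_holder; auto.
Qed.

Lemma Rsum_Sl n f : Rsum (S n) f = f 0%nat + Rsum n (fun j => f (S j)).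
Proof. rewrite (Rsum_add 1 n). simpl. ring. Qed.

(** The variables are integrated one at a time; by subadditivity each adds at most the mean of
    [phi s] to [hyp s (sqrt acc)]. *)
Lemma ind_aux_le (g : nat -> R -> C) s n :
  0 <= s -> forall k acc, 0 <= acc ->
  (forall j, (k <= j)%nat -> ccper (g j)) ->
  ind_aux g (List.seq k n) acc
  <= hyp s (sqrt acc) + Rsum n (fun j => torus_E (fun t => phi s (Cmod (g (k + j)%nat t)))).
Proof.
  intros Hs. induction n as [|n IH]; intros k acc Hacc Hg.
  - simpl. rewrite Rplus_0_r. apply hyp_ge_r, sqrt_pos.
  - assert (Hgk : cper (fun t => Cmod (g k t))) by (apply cper_Cmod, Hg; lia).
    assert (Hacc' : cper (fun t => acc + Cmod (g k t) ^ 2))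
      by (apply cper_plus; [apply cper_const | now apply cper_pow2]).
    cbn [List.seq ind_aux].
    rewrite Rsum_Sl, Nat.add_0_r.
    set (R1 := Rsum n (fun j => torus_E (fun t => phi s (Cmod (g (k + S j)%nat t))))).
    assert (HR : forall t, ind_aux g (List.seq (S k) n) (acc + Cmod (g k t) ^ 2)
       <= hyp s (sqrt acc) + phi s (Cmod (g k t)) + R1).
    { intros t. eapply Rle_trans; [apply IH|].
      - pose proof (pow2_ge_0 (Cmod (g k t))). lra.
      - intros; apply Hg; lia.
      - apply Rplus_le_compat.
        + pose proof (phi_subadd s (sqrt acc) (Cmod (g k t)) Hs) as H.
          unfold phi in *.
          replace (sqrt (acc + Cmod (g k t) ^ 2)) with (hyp (sqrt acc) (Cmod (g k t))); [lra|].
          unfold hyp. now rewrite pow2_sqrt.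
        + right. unfold R1. apply Rsum_ext; intros.
          now replace (S k + j)%nat with (k + S j)%nat by lia. }
    eapply Rle_trans; [apply torus_E_le; [| |exact HR]|].
    + apply cper_ind_aux; auto. intros j Hj. apply in_seq in Hj. apply Hg; lia.
    + apply cper_plus; [|apply cper_const].
      apply cper_plus; [apply cper_const | now apply cper_phi].
    + assert (Hph : cper (fun t => phi s (Cmod (g k t)))) by now apply cper_phi.
      rewrite (torus_E_plus (fun t => hyp s (sqrt acc) + phi s (Cmod (g k t))) (fun _ => R1)).
      * rewrite torus_E_plus, !torus_E_const; auto; [lra | apply cper_const].
      * apply cper_plus; auto; apply cper_const.
      * apply cper_const.
Qed.

Lemma sqrt_sum_n_m_l2 n (v : nat -> C) :
  sqrt (sum_n_m (fun k => Cmod (v k) ^ 2) 1 n) = l2 n (fun k => v (S k)).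
Proof. now rewrite sum_n_m_1_Rsum. Qed.

(** Since [x <= hyp (2 * s) x = 2 * s + phi (2 * s) x], both square functions have mean at most
    [2 * s] plus the sum of the means of [phi (2 * s)]. That sum is at most [2 * m * s], which gives
    the constant [/ (2 * (m + 1))]. *)
Lemma cond_i_bounds (d N : nat -> nat) (a : nat) (C0 : R) :
  (forall k, (1 <= k)%nat -> (0 < d k)%nat) ->
  (forall k, (1 <= k)%nat -> (0 < N k)%nat /\ forall b, (2 ^ b * N k <= N (k + b))%nat) ->
  (forall k, (1 <= k)%nat -> INR (d k) <= C0 * INR (N (k + a)%nat)) ->
  exists c, 0 < c /\ forall n (coef : nat -> nat -> C),
    let f := fun k => trigpoly (coef k) (d k) in
    c * torus_E (fun t => l2 n (fun k => condexpN (N (S k)) (f (S k)) t))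
      <= torus_E (fun t => l2 n (fun k => f (S k) t)) /\
    c * ind_norm (fun k => condexpN (N k) (f k)) n
      <= torus_E (fun t => l2 n (fun k => f (S k) t)).
Proof.
  intros Hd HN Hi.
  destruct (torus_E_phi_bound d N a C0 Hd HN Hi) as [m Hm].
  assert (Hm0 : 0 <= INR m) by apply pos_INR.
  assert (Hc : 0 < / (2 * (INR m + 1))) by (apply Rinv_0_lt_compat; lra).
  exists (/ (2 * (INR m + 1))). split; auto.
  intros n coef f. specialize (Hm n coef). cbv zeta in Hm.
  set (s := torus_E (fun t => l2 n (fun k => f (S k) t))).
  change (torus_E (fun t => l2 n (fun k => trigpoly (coef (S k)) (d (S k)) t))) with s in Hm.
  assert (Hs : 0 <= s).
  { apply torus_E_ge_const; [apply (cper_l2_trigpoly (fun k => d (S k)) (fun k => coef (S k)))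
    | intros; apply l2_nonneg]. }
  assert (Hcp : forall k, (1 <= k)%nat -> ccper (condexpN (N k) (f k))).
  { intros k Hk. apply ccper_condexpN; [now apply HN | apply ccper_trigpoly]. }
  set (R1 := Rsum n (fun k => torus_E (fun t => phi (2 * s)
        (Cmod (condexpN (N (S k)) (f (S k)) t))))).
  assert (HR1 : R1 <= 2 * INR m * s) by exact Hm.
  assert (Hfin : forall X, X <= 2 * s + R1 -> / (2 * (INR m + 1)) * X <= s).
  { intros X HX. apply Rmult_le_reg_l with (2 * (INR m + 1)); [lra|].
    rewrite <- Rmult_assoc, Rinv_r, Rmult_1_l by lra. lra. }
  split; apply Hfin.
  - assert (Hph : forall k, cper (fun t =>
              phi (2 * s) (Cmod (condexpN (N (S k)) (f (S k)) t))))
      by (intros; apply cper_phi, cper_Cmod, Hcp; lia).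
    assert (HS : cper (fun t => Rsum n (fun k =>
              phi (2 * s) (Cmod (condexpN (N (S k)) (f (S k)) t)))))
      by (apply (cper_sum n (fun k t =>
            phi (2 * s) (Cmod (condexpN (N (S k)) (f (S k)) t)))); auto).
    apply Rle_trans with (torus_E (fun t => 2 * s + Rsum n (fun k =>
      phi (2 * s) (Cmod (condexpN (N (S k)) (f (S k)) t))))).
    + apply torus_E_le.
      * apply (cper_l2 n (fun k => condexpN (N (S k)) (f (S k)))).
        intros; apply Hcp; lia.
      * apply cper_plus; auto; apply cper_const.
      * intros t. set (v := fun k => condexpN (N (S k)) (f (S k)) t).
        pose proof (phi_l2 (2 * s) n v ltac:(lra)) as H.
        pose proof (hyp_ge_r (2 * s) (l2 n v) (l2_nonneg _ _)) as H2.
        unfold phi in H at 1. unfold v in *. lra.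
    + rewrite torus_E_plus, torus_E_const by (auto; apply cper_const).
      rewrite (torus_E_sum n (fun k t =>
        phi (2 * s) (Cmod (condexpN (N (S k)) (f (S k)) t)))) by auto.
      apply Rle_refl.
  - eapply Rle_trans.
    + apply (ind_aux_le _ (2 * s) n); try lra. exact Hcp.
    + rewrite sqrt_0, hyp_0_r by lra. apply Rle_refl.
Qed.

(** * Riesz products *)

Fixpoint Rprod (n : nat) (f : nat -> R) : R :=
  match n with O => 1 | S k => Rprod k f * f k end.

Lemma Rprod_ext n f g :
  (forall j, (j < n)%nat -> f j = g j) -> Rprod n f = Rprod n g.
Proof.
  induction n as [|n IH]; intros H; simpl; auto. rewrite IH, H; auto.
Qed.

Lemma Rprod_nonneg n f : (forall j, (j < n)%nat -> 0 <= f j) -> 0 <= Rprod n f.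
Proof.
  induction n as [|n IH]; intros H; simpl; [lra|]. apply Rmult_le_pos; auto.
Qed.

Lemma Rprod_le n f g :
  (forall j, (j < n)%nat -> 0 <= f j <= g j) -> Rprod n f <= Rprod n g.
Proof.
  induction n as [|n IH]; intros H; simpl; [lra|].
  apply Rmult_le_compat; auto; try (apply H; lia).
  apply Rprod_nonneg; intros; apply H; lia.
Qed.

Lemma Rprod_const n c : Rprod n (fun _ => c) = c ^ n.
Proof. induction n as [|n IH]; simpl; auto. rewrite IH; ring. Qed.

Lemma Rprod_add m n f : Rprod (m + n) f = Rprod m f * Rprod n (fun j => f (m + j)%nat).
Proof.
  induction n as [|n IH]; simpl.
  - rewrite Nat.add_0_r; ring.
  - replace (m + S n)%nat with (S (m + n)) by lia; simpl. rewrite IH; ring.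
Qed.

Lemma sqrt_Rprod n f :
  (forall j, (j < n)%nat -> 0 <= f j) -> sqrt (Rprod n f) = Rprod n (fun j => sqrt (f j)).
Proof.
  induction n as [|n IH]; intros H; simpl; [apply sqrt_1|].
  rewrite sqrt_mult, IH; auto. apply Rprod_nonneg; auto.
Qed.

(** Cosine polynomials of degree at most [m] with constant term [mu]. A predicate up to pointwise
    equality replaces explicit coefficients, so that means and analytic forms follow by
    induction. *)
Inductive cospoly (m : nat) : R -> (R -> R) -> Prop :=
| cospoly_const c f : (forall t, f t = c) -> cospoly m c f
| cospoly_add c k mu f g :
    (0 < k <= m)%nat -> cospoly m mu f ->
    (forall t, g t = f t + c * cos (INR k * t)) -> cospoly m mu g.

Lemma cospoly_plus m mu nu f g h :
  cospoly m mu f -> cospoly m nu g -> (forall t, h t = f t + g t) ->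
  cospoly m (mu + nu) h.
Proof.
  intros Hf Hg. revert h. induction Hg as [c g Hc | c k nu g g' Hk Hg IH Hg'];
    intros h Hh.
  - revert h Hh. induction Hf as [c0 f Hc0 | c0 k mu f f' Hk Hf IH Hf']; intros h Hh.
    + apply cospoly_const. intros t. rewrite Hh, Hc0, Hc. auto.
    + apply (cospoly_add m c0 k _ (fun t => f t + g t)); auto.
      intros t. rewrite Hh, Hf'. ring.
  - apply (cospoly_add m c k _ (fun t => f t + g t)); auto.
    intros t. rewrite Hh, Hg'. ring.
Qed.

Lemma cospoly_scal m mu f c h :
  cospoly m mu f -> (forall t, h t = c * f t) -> cospoly m (c * mu) h.
Proof.
  intros Hf. revert h. induction Hf as [c0 f Hc0 | c0 k mu f f' Hk Hf IH Hf'];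
    intros h Hh.
  - apply cospoly_const. intros t. now rewrite Hh, Hc0.
  - apply (cospoly_add m (c * c0) k _ (fun t => c * f t)); auto.
    intros t. rewrite Hh, Hf'. ring.
Qed.

Lemma cospoly_weaken m m' mu f : (m <= m')%nat -> cospoly m mu f -> cospoly m' mu f.
Proof.
  intros Hm Hf. induction Hf as [c f Hc | c k mu f f' Hk Hf IH Hf'].
  - now apply cospoly_const.
  - apply (cospoly_add m' c k mu f); auto; lia.
Qed.

(* All frequencies [M - k] and [M + k] are nonzero, so the constant term disappears. *)
Lemma cospoly_mult_cos m mu f M h :
  (m < M)%nat -> cospoly m mu f -> (forall t, h t = f t * cos (INR M * t)) ->
  cospoly (m + M) 0 h.
Proof.
  intros Hm Hf. revert h. induction Hf as [c f Hc | c k mu f f' Hk Hf IH Hf'];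
    intros h Hh.
  - apply (cospoly_add _ c M _ (fun _ => 0)); [lia | now apply cospoly_const |].
    intros t. rewrite Hh, Hc. ring.
  - apply (cospoly_add _ (c / 2) (M + k) _
      (fun t => f t * cos (INR M * t) + c / 2 * cos (INR (M - k) * t))); [lia | |].
    + apply (cospoly_add _ (c / 2) (M - k) _ (fun t => f t * cos (INR M * t)));
        [lia | now apply IH | auto].
    + intros t. rewrite Hh, Hf', plus_INR, minus_INR by lia.
      replace ((INR M - INR k) * t) with (INR M * t - INR k * t) by ring.
      replace ((INR M + INR k) * t) with (INR M * t + INR k * t) by ring.
      rewrite cos_plus, cos_minus. field.
Qed.

Lemma cper_cospoly m mu f : cospoly m mu f -> cper f.
Proof.
  induction 1 as [c f Hc | c k mu f f' Hk Hf IH Hf'].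
  - apply cper_ext with (fun _ => c); auto. apply cper_const.
  - apply cper_ext with (fun t => f t + c * cos (INR k * t + 0)).
    + intros t. now rewrite Hf', Rplus_0_r.
    + apply cper_plus; auto.
      apply cper_mult; [apply cper_const | exact (proj1 (cper_cos_sin k 0))].
Qed.

Lemma torus_E_cospoly m mu f : cospoly m mu f -> torus_E f = mu.
Proof.
  induction 1 as [c f Hc | c k mu f f' Hk Hf IH Hf'].
  - rewrite (torus_E_ext _ (fun _ => c)) by auto. apply torus_E_const.
  - rewrite (torus_E_ext _ (fun t => f t + c * cos (INR k * t + 0))).
    + pose proof (proj1 (cper_cos_sin k 0)) as Hcos.
      rewrite torus_E_plus, torus_E_scal, torus_E_cos, IH by
        (try lia; eauto using cper_cospoly, cper_mult, cper_const). ring.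
    + intros t. now rewrite Hf', Rplus_0_r.
Qed.

(** The nonzero frequencies lie strictly below [N], so their sums over the lattice vanish. *)
Lemma cospoly_lattice_mean m mu f N t :
  (m < N)%nat -> cospoly m mu f -> Rsum N (fun j => f (t + node N j)) = INR N * mu.
Proof.
  intros Hm. induction 1 as [c f Hc | c k mu f f' Hk Hf IH Hf'].
  - rewrite <- Rsum_const. apply Rsum_ext; auto.
  - rewrite (Rsum_ext _ _ (fun j => f (t + node N j)
               + c * cos (INR k * t + INR k * node N j))).
    + rewrite Rsum_plus, Rsum_scal, cos_lattice_sum by lia. rewrite IH. ring.
    + intros j _. rewrite Hf'. now rewrite Rmult_plus_distr_l.
Qed.

Definition monomial (k : nat) (x : C) (j : nat) : C :=
  if Nat.eq_dec j k then x else RtoC 0.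

Lemma trigpoly_monomial k x D t :
  (k <= D)%nat -> trigpoly (monomial k x) D t = Cmult x (cexpi (INR k * t)).
Proof.
  intros Hk. rewrite trigpoly_Csum.
  rewrite (Csum_ext _ _ (fun j => if Nat.eq_dec j k
                                  then Cmult x (cexpi (INR k * t)) else RtoC 0)).
  - rewrite Csum_delta. destruct (lt_dec k (S D)); [auto | lia].
  - intros j _. unfold monomial. destruct (Nat.eq_dec j k) as [->|]; [auto | ring].
Qed.

Lemma trigpoly_plus a b D t :
  trigpoly (fun j => Cplus (a j) (b j)) D t = Cplus (trigpoly a D t) (trigpoly b D t).
Proof.
  rewrite !trigpoly_Csum, <- Csum_plus. apply Csum_ext; intros; ring.
Qed.

(** Modulation by frequency [q >= m] moves the spectrum into [[0, 2 q]]. One coefficient sequence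
    serves all [D >= 2 q], as needed for taking many [f_k] equal under different degree bounds. *)
Lemma cospoly_trigpoly m mu f q :
  (m <= q)%nat -> cospoly m mu f ->
  exists a, forall D t, (2 * q <= D)%nat ->
    trigpoly a D t = Cmult (cexpi (INR q * t)) (RtoC (f t)).
Proof.
  intros Hm. induction 1 as [c f Hc | c k mu f f' Hk Hf IH Hf'].
  - exists (monomial q (RtoC c)). intros D t HD.
    rewrite trigpoly_monomial, Hc by lia. ring.
  - destruct IH as [a Ha].
    exists (fun j => Cplus (Cplus (a j) (monomial (q + k) (RtoC (c / 2)) j))
                       (monomial (q - k) (RtoC (c / 2)) j)).
    intros D t HD. rewrite !trigpoly_plus, Ha, !trigpoly_monomial by lia.
    rewrite Hf', plus_INR, minus_INR by lia.
    replace ((INR q + INR k) * t) with (INR q * t + INR k * t) by ring.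
    replace ((INR q - INR k) * t) with (INR q * t + - (INR k * t)) by ring.
    rewrite !cexpi_plus, cexpi_opp.
    replace (RtoC (f t + c * cos (INR k * t)))
      with (Cplus (RtoC (f t)) (Cmult (RtoC (c / 2))
              (Cplus (cexpi (INR k * t)) (Cconj (cexpi (INR k * t)))))); [ring|].
    unfold cexpi, Cconj, RtoC, Cmult, Cplus; simpl. f_equal; field.
Qed.

(** The first [T] factors have degree below [M T], so multiplying them by [cos (M T t)] or
    [cos (2 M T t)] creates no constant term and the means multiply. The new degree stays below
    [3 * M T]. The double frequency serves the majorant of [sqrt (1 + cos)]. *)
Lemma cospoly_riesz (M : nat -> nat) (u v w : nat -> R) :
  (0 < M 0)%nat -> (forall l, (3 * M l <= M (S l))%nat) ->
  forall T, exists m, (m < M T)%nat /\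
    cospoly m (Rprod T u) (fun t => Rprod T (fun l =>
      u l + v l * cos (INR (M l) * t) + w l * cos (INR (2 * M l) * t))).
Proof.
  intros H0 HM T. induction T as [|T (m & Hm & IH)].
  - exists 0%nat. split; auto. now apply cospoly_const.
  - exists (m + 2 * M T)%nat. split; [specialize (HM T); lia|]. cbn [Rprod].
    set (f := fun t => Rprod T (fun l =>
      u l + v l * cos (INR (M l) * t) + w l * cos (INR (2 * M l) * t))) in *.
    replace (Rprod T u * u T) with (u T * Rprod T u + (v T * 0 + w T * 0)) by ring.
    apply (cospoly_plus _ _ _ (fun t => u T * f t)
      (fun t => v T * (f t * cos (INR (M T) * t)) + w T * (f t * cos (INR (2 * M T) * t)))).
    + apply (cospoly_weaken m); [lia|]. now apply (cospoly_scal m _ f).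
    + apply (cospoly_plus _ _ _ (fun t => v T * (f t * cos (INR (M T) * t)))
        (fun t => w T * (f t * cos (INR (2 * M T) * t)))); auto.
      * apply (cospoly_scal _ _ (fun t => f t * cos (INR (M T) * t))); auto.
        apply (cospoly_weaken (m + M T)); [lia|].
        apply (cospoly_mult_cos m (Rprod T u) f); auto.
      * apply (cospoly_scal _ _ (fun t => f t * cos (INR (2 * M T) * t))); auto.
        apply (cospoly_mult_cos m (Rprod T u) f); auto. lia.
    + intros t. unfold f. ring.
Qed.

(** The factors from [i] to [i + n - 1]: conditioning removes the initial factors, so tails occur as
    well. *)
Definition riesz (M : nat -> nat) (i n : nat) (t : R) : R :=
  Rprod n (fun l => 1 + cos (INR (M (i + l)%nat) * t)).

Lemma riesz_nonneg M i n t : 0 <= riesz M i n t.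
Proof.
  apply Rprod_nonneg; intros.
  pose proof (COS_bound (INR (M (i + j)%nat) * t)). lra.
Qed.

Lemma riesz_split M i m n t : riesz M i (m + n) t = riesz M i m t * riesz M (i + m) n t.
Proof.
  unfold riesz. rewrite Rprod_add. f_equal. apply Rprod_ext; intros.
  now rewrite Nat.add_assoc.
Qed.

(** Ratios at least 3 make means of products multiply; divisibility makes the factors from [i] on
    periodic with period [2 pi / M i]. *)
Definition scales (M : nat -> nat) : Prop :=
  (0 < M 0)%nat /\ (forall l, (3 * M l <= M (S l))%nat) /\
  (forall l, Nat.divide (M l) (M (S l))).

Lemma scale_pos M i : scales M -> (0 < M i)%nat.
Proof. intros (H0 & HM & _). induction i; auto. specialize (HM i). lia. Qed.

Lemma riesz_cospoly M i n : scales M ->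
  exists m, (m < M (i + n))%nat /\ cospoly m 1 (riesz M i n).
Proof.
  intros HS.
  destruct (cospoly_riesz (fun l => M (i + l)%nat) (fun _ => 1) (fun _ => 1) (fun _ => 0))
    with (T := n) as (m & Hm & H).
  - rewrite Nat.add_0_r. now apply scale_pos.
  - intros l. rewrite Nat.add_succ_r. apply HS.
  - exists m. split; auto. rewrite Rprod_const, pow1 in H.
    replace 1 with (1 * 1 + 0) by ring.
    eapply cospoly_plus; [eapply cospoly_scal; [exact H | reflexivity]
      | now apply (cospoly_const m 0 (fun _ => 0)) |].
    intros t. simpl. unfold riesz. rewrite Rplus_0_r, Rmult_1_l.
    apply Rprod_ext; intros; ring.
Qed.

Lemma cper_riesz M i n : scales M -> cper (riesz M i n).
Proof.
  intros HS. destruct (riesz_cospoly M i n HS) as (m & _ & H).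
  eapply cper_cospoly; eauto.
Qed.

Lemma torus_E_riesz M i n : scales M -> torus_E (riesz M i n) = 1.
Proof.
  intros HS. destruct (riesz_cospoly M i n HS) as (m & _ & H).
  eapply torus_E_cospoly; eauto.
Qed.

(** A polynomial majorant is used because its mean in [x = cos] is explicit; the quadratic term
    brings that mean below 1. *)
Lemma sqrt_1_plus_le x : -1 <= x <= 1 -> sqrt (1 + x) <= 1 + x / 2 - x ^ 2 / 16.
Proof.
  intros Hx. rewrite <- (sqrt_pow2 (1 + x / 2 - x ^ 2 / 16)) by nra.
  apply sqrt_le_1_alt.
  (* the difference is x^2 (1/8 - x/16 + x^2/256) *)
  assert (0 <= x ^ 2 * (1 / 8 - x / 16 + x ^ 2 / 256)).
  { apply Rmult_le_pos; [apply pow2_ge_0|]. pose proof (pow2_ge_0 x). lra. }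
  nra.
Qed.

(* 31/32 is the mean of the majorant 1 + cos/2 - cos^2/16 of sqrt (1 + cos). *)
Lemma torus_E_sqrt_riesz M i m n : scales M ->
  torus_E (fun t => sqrt (riesz M i (m + n) t * riesz M (i + m) n t)) <= (31 / 32) ^ m.
Proof.
  intros HS.
  (* For the first [m] factors these are the coefficients of [1 + cos / 2 - cos^2 / 16], rewritten
     with the double angle; for the others, those of [1 + cos]. *)
  set (u := fun l => if lt_dec l m then 31 / 32 else 1).
  set (v := fun l => if lt_dec l m then 1 / 2 else 1).
  set (w := fun l => if lt_dec l m then - (1 / 32) else 0).
  destruct (cospoly_riesz (fun l => M (i + l)%nat) u v w)
    with (T := (m + n)%nat) as (k & _ & H).
  - rewrite Nat.add_0_r. now apply scale_pos.
  - intros l. rewrite Nat.add_succ_r. apply HS.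
  - assert (Hu : Rprod (m + n) u = (31 / 32) ^ m).
    { rewrite Rprod_add, (Rprod_ext m _ (fun _ => 31 / 32)), (Rprod_ext n _ (fun _ => 1)).
      - rewrite !Rprod_const, pow1. ring.
      - intros j Hj. unfold u. destruct (lt_dec (m + j) m); [lia | auto].
      - intros j Hj. unfold u. destruct (lt_dec j m); [auto | lia]. }
    rewrite <- Hu, <- (torus_E_cospoly _ _ _ H).
    apply torus_E_le.
    + apply cper_sqrt, cper_mult; now apply cper_riesz.
    + eapply cper_cospoly; eauto.
    (* The factors common to both products form a square and leave the root. *)
    + intros t. rewrite riesz_split, Rmult_assoc, sqrt_mult.
      2: apply riesz_nonneg. 2: apply Rmult_le_pos; apply riesz_nonneg.
      rewrite sqrt_square by apply riesz_nonneg.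
      rewrite Rprod_add. apply Rmult_le_compat; try apply sqrt_pos; try apply riesz_nonneg.
      * unfold riesz. rewrite sqrt_Rprod.
        2: { intros j _. pose proof (COS_bound (INR (M (i + j)%nat) * t)). lra. }
        apply Rprod_le. intros j Hj. split; [apply sqrt_pos|].
        unfold u, v, w. destruct (lt_dec j m); [|lia].
        eapply Rle_trans; [apply sqrt_1_plus_le, COS_bound|].
        replace (INR (2 * M (i + j)%nat) * t) with (2 * (INR (M (i + j)%nat) * t))
          by (rewrite mult_INR; simpl; ring).
        rewrite cos_2a_cos. right. field.
      * right. apply Rprod_ext; intros j Hj. unfold u, v, w.
        destruct (lt_dec (m + j) m); [lia|]. rewrite Nat.add_assoc. ring.
Qed.

Lemma scale_divide M i n : scales M -> Nat.divide (M i) (M (i + n)%nat).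
Proof.
  intros (_ & _ & HMdiv).
  induction n as [|n IH].
  - rewrite Nat.add_0_r. apply Nat.divide_refl.
  - rewrite Nat.add_succ_r. eapply Nat.divide_trans; eauto.
Qed.

Lemma scale_node M i n j : scales M ->
  exists r : nat, INR (M (i + n)%nat) * node (M i) j = 2 * INR r * PI.
Proof.
  intros HS. destruct (scale_divide M i n HS) as [c Hc]. exists (c * j)%nat.
  assert (INR (M i) <> 0) by (apply not_0_INR; pose proof (scale_pos M i HS); lia).
  rewrite Hc, !mult_INR. unfold node. field. auto.
Qed.

(** The carrier and the tail from [i] on are invariant under the lattice. The first [i] factors form
    a cosine polynomial of degree below [M i], so their lattice mean is their mean 1. *)
Lemma condexpN_riesz M i n t : scales M ->
  condexpN (M i) (fun t =>
    Cmult (cexpi (INR (M (i + n)%nat) * t)) (RtoC (riesz M 0 (i + n) t))) t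
  = Cmult (cexpi (INR (M (i + n)%nat) * t)) (RtoC (riesz M i n t)).
Proof.
  intros HS. pose proof (scale_pos M i HS) as Hi.
  assert (Hi' : INR (M i) <> 0) by (apply not_0_INR; lia).
  rewrite condexpN_Csum by auto.
  rewrite (Csum_ext _ _ (fun j =>
    Cmult (Cmult (cexpi (INR (M (i + n)%nat) * t)) (RtoC (riesz M i n t)))
      (RtoC (riesz M 0 i (t + node (M i) j))))).
  - rewrite Csum_scal, Csum_RtoC.
    destruct (riesz_cospoly M 0 i HS) as (m & Hm & H).
    rewrite (cospoly_lattice_mean m 1 _ (M i) t Hm H), Rmult_1_r, Cmult_comm.
    rewrite <- Cmult_assoc, <- RtoC_mult, Rinv_r by auto. ring.
  - intros j _.
    assert (Hq : cexpi (INR (M (i + n)%nat) * (t + node (M i) j))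
                 = cexpi (INR (M (i + n)%nat) * t)).
    { destruct (scale_node M i n j HS) as [r Hr].
      rewrite Rmult_plus_distr_l, Hr. unfold cexpi. now rewrite cos_period, sin_period. }
    assert (HG : riesz M i n (t + node (M i) j) = riesz M i n t).
    { apply Rprod_ext; intros l _. f_equal. destruct (scale_node M i l j HS) as [r Hr].
      now rewrite Rmult_plus_distr_l, Hr, cos_period. }
    rewrite Hq, riesz_split. simpl (0 + i)%nat. rewrite HG, RtoC_mult. ring.
Qed.

(** * From (ii) or (iii) to (i) *)

(** [hyp] dominates the larger of [s] and [x], and the smaller one is at most the geometric mean. *)
Lemma hyp_ge_sub_sqrt s x : 0 <= s -> 0 <= x -> s + x - sqrt (s * x) <= hyp s x.
Proof.
  intros Hs Hx.
  assert (H : forall a b, 0 <= a <= b -> a <= sqrt (a * b)).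
  { intros a b Hab. rewrite <- (sqrt_square a) at 1 by lra.
    apply sqrt_le_1_alt. nra. }
  pose proof (hyp_ge_l s x Hs). pose proof (hyp_ge_r s x Hx).
  destruct (Rle_or_lt s x).
  - pose proof (H s x ltac:(lra)). lra.
  - pose proof (H x s ltac:(lra)) as H3. rewrite (Rmult_comm x s) in H3. lra.
Qed.

Lemma sqrt_Rsum_le n f :
  (forall j, 0 <= f j) -> sqrt (Rsum n f) <= Rsum n (fun j => sqrt (f j)).
Proof.
  intros Hf. induction n as [|n IH]; simpl; [rewrite sqrt_0; lra|].
  eapply Rle_trans; [apply sqrt_plus_le; auto; now apply Rsum_nonneg | lra].
Qed.

Lemma l2_le_sum n v : l2 n v <= Rsum n (fun i => Cmod (v i)).
Proof.
  unfold l2. eapply Rle_trans; [apply sqrt_Rsum_le; intros; apply pow2_ge_0|].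
  right. apply Rsum_ext; intros. apply sqrt_pow2, Cmod_ge_0.
Qed.

(** The Euclidean norm is nearly additive when the pairwise geometric means are small. *)
Lemma l2_ge n v :
  Rsum n (fun b => Cmod (v b))
  - Rsum n (fun b' => Rsum b' (fun b => sqrt (Cmod (v b) * Cmod (v b'))))
  <= l2 n v.
Proof.
  induction n as [|n IH]; [simpl; unfold l2; simpl; rewrite sqrt_0; lra|].
  rewrite l2_S. cbn [Rsum].
  pose proof (hyp_ge_sub_sqrt (l2 n v) (Cmod (v n)) (l2_nonneg _ _) (Cmod_ge_0 _)) as H.
  assert (H2 : sqrt (l2 n v * Cmod (v n))
               <= Rsum n (fun b => sqrt (Cmod (v b) * Cmod (v n)))).
  { eapply Rle_trans; [|apply sqrt_Rsum_le].
    - apply sqrt_le_1_alt.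
      rewrite (Rsum_ext n (fun b => Cmod (v b) * Cmod (v n))
                 (fun b => Cmod (v n) * Cmod (v b))) by (intros; ring).
      rewrite Rsum_scal, Rmult_comm. apply Rmult_le_compat_l; [apply Cmod_ge_0|].
      apply l2_le_sum.
    - intros; apply Rmult_le_pos; apply Cmod_ge_0. }
  lra.
Qed.

(** The independent analogue: means of geometric means factor into products of means of square
    roots. The error [(sqrt (sqrt acc) + e) * e] has a form stable under the recursion, since
    [sqrt (hyp s x) <= sqrt s + sqrt x]. *)
Lemma ind_aux_ge (g : nat -> R -> C) n : forall k acc, 0 <= acc ->
  (forall j, (k <= j)%nat -> ccper (g j)) ->
  let e := Rsum n (fun j => torus_E (fun t => sqrt (Cmod (g (k + j)%nat t)))) in
  sqrt acc + Rsum n (fun j => torus_E (fun t => Cmod (g (k + j)%nat t)))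
  - (sqrt (sqrt acc) + e) * e
  <= ind_aux g (List.seq k n) acc.
Proof.
  induction n as [|n IH]; intros k acc Hacc Hg; cbv zeta.
  - simpl. lra.
  - assert (Hgk : cper (fun t => Cmod (g k t))) by (apply cper_Cmod, Hg; lia).
    assert (Hsg : cper (fun t => sqrt (Cmod (g k t)))) by now apply cper_sqrt.
    cbn [List.seq ind_aux].
    rewrite !Rsum_Sl, Nat.add_0_r.
    set (e1 := torus_E (fun t => sqrt (Cmod (g k t)))).
    set (e' := Rsum n (fun j => torus_E (fun t => sqrt (Cmod (g (k + S j)%nat t))))).
    set (S' := Rsum n (fun j => torus_E (fun t => Cmod (g (k + S j)%nat t)))).
    assert (He1 : 0 <= e1) by (apply torus_E_ge_const; auto; intros; apply sqrt_pos).
    assert (He' : 0 <= e').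
    { apply Rsum_nonneg; intros j _. apply torus_E_ge_const; [|intros; apply sqrt_pos].
      apply cper_sqrt, cper_Cmod, Hg; lia. }
    set (s := sqrt acc). assert (Hs : 0 <= s) by apply sqrt_pos.
    pose proof (sqrt_pos s) as Hss.
    assert (HR : forall t,
       (s + S' - (sqrt s + e') * e') + Cmod (g k t)
         + (- (sqrt s + e')) * sqrt (Cmod (g k t))
       <= ind_aux g (List.seq (S k) n) (acc + Cmod (g k t) ^ 2)).
    { intros t. pose proof (Cmod_ge_0 (g k t)) as Hx. set (x := Cmod (g k t)) in *.
      eapply Rle_trans; [|apply IH].
      2: { pose proof (pow2_ge_0 x). lra. }
      2: { intros; apply Hg; lia. }
      rewrite (Rsum_ext n (fun j => torus_E (fun t => sqrt (Cmod (g (S k + j)%nat t))))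
        (fun j => torus_E (fun t => sqrt (Cmod (g (k + S j)%nat t)))))
        by (intros j _; now replace (S k + j)%nat with (k + S j)%nat by lia).
      rewrite (Rsum_ext n (fun j => torus_E (fun t => Cmod (g (S k + j)%nat t)))
        (fun j => torus_E (fun t => Cmod (g (k + S j)%nat t))))
        by (intros j _; now replace (S k + j)%nat with (k + S j)%nat by lia).
      fold e' S'.
      replace (sqrt (acc + x ^ 2)) with (hyp s x)
        by (unfold hyp, s; now rewrite pow2_sqrt).
      pose proof (hyp_ge_sub_sqrt s x Hs Hx) as H1. rewrite sqrt_mult in H1 by auto.
      assert (H2 : sqrt (hyp s x) <= sqrt s + sqrt x).
      { eapply Rle_trans; [|apply sqrt_plus_le; auto]. apply sqrt_le_1_alt.
        pose proof (hyp_triangle s 0 0 x) as H. rewrite Rplus_0_l, Rplus_0_r in H.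
        rewrite hyp_0_r in H by auto. unfold hyp in H at 2.
        replace (0 ^ 2 + x ^ 2) with (x ^ 2) in H by ring.
        rewrite sqrt_pow2 in H by auto. exact H. }
      assert (H3 : sqrt (hyp s x) * e' <= (sqrt s + sqrt x) * e')
        by (apply Rmult_le_compat_r; auto).
      lra. }
    assert (Hpl : cper (fun t => (s + S' - (sqrt s + e') * e') + Cmod (g k t)))
      by (apply cper_plus; auto; apply cper_const).
    assert (Hps : cper (fun t => (- (sqrt s + e')) * sqrt (Cmod (g k t))))
      by (apply cper_mult; auto; apply cper_const).
    eapply Rle_trans; [|apply torus_E_le; [| |exact HR]].
    + rewrite (torus_E_plus (fun t => (s + S' - (sqrt s + e') * e') + Cmod (g k t)))
        by auto.
      rewrite torus_E_scal by auto.
      rewrite torus_E_plus by (auto; apply cper_const). rewrite torus_E_const.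
      fold e1. assert (0 <= e1 * e1) by nra. assert (0 <= e1 * e') by nra. lra.
    + apply cper_plus; auto.
    + apply cper_ind_aux.
      * intros j Hj. apply in_seq in Hj. apply Hg; lia.
      * apply cper_plus; [apply cper_const | now apply cper_pow2].
Qed.

Lemma Rsum_sparse k0 s n x :
  (1 <= s)%nat -> (forall j, (j < k0)%nat -> x j = 0) ->
  (forall i r, (0 < r < s)%nat -> x (k0 + (i * s + r))%nat = 0) ->
  Rsum (k0 + n * s) x = Rsum n (fun i => x (k0 + i * s)%nat).
Proof.
  intros Hs H0 Hr. rewrite Rsum_add, (Rsum_ext k0 _ (fun _ => 0)) by auto.
  rewrite Rsum_const, (Rsum_blocks s n (fun j => x (k0 + j)%nat)).
  rewrite Rmult_0_r, Rplus_0_l.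
  apply Rsum_ext; intros i _. destruct s as [|s]; [lia|].
  rewrite Rsum_Sl, (Rsum_ext s _ (fun _ => 0)) by (intros; apply Hr; lia).
  rewrite Rsum_const, Nat.add_0_r. ring.
Qed.

Lemma condexpN_ext N g h t : (forall x, g x = h x) -> condexpN N g t = condexpN N h t.
Proof. intros H. unfold condexpN. f_equal. apply sum_n_ext; auto. Qed.

Lemma condexpN_zero N t : (0 < N)%nat -> condexpN N (fun _ => RtoC 0) t = RtoC 0.
Proof. intros HN. rewrite condexpN_Csum, Csum_0 by auto. ring. Qed.

Lemma quarter_sum_le n : Rsum n (fun b => (1 / 4) ^ (n - b)) <= 1 / 2.
Proof.
  induction n as [|n IH]; [simpl; lra|]. cbn [Rsum].
  rewrite (Rsum_ext n _ (fun b => 1 / 4 * (1 / 4) ^ (n - b))).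
  - rewrite Rsum_scal. replace (S n - n)%nat with 1%nat by lia. rewrite pow_1. lra.
  - intros b Hb. replace (S n - b)%nat with (S (n - b)) by lia. reflexivity.
Qed.

(** The test family: [n] equal modulated Riesz products at equally spaced indices, and zero
    elsewhere. Its square function has mean [sqrt n], while the conditional expectations are nearly
    disjoint tails of mean 1. Taking every second [N] ensures the ratio required by [scales]. *)
Lemma riesz_test (d N : nat -> nat) (k0 L n : nat) :
  (forall l, (0 < N (S l))%nat) ->
  scales (fun l => N (S k0 + 2 * l)%nat) ->
  (forall l, (d (S k0) <= d (S k0 + l))%nat) ->
  (1 <= L)%nat -> (31 / 32) ^ L <= 1 / 4 ->
  (2 * N (S k0 + 2 * (n * L)) <= d (S k0))%nat ->
  exists (K : nat) (coef : nat -> nat -> C),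
    let f := fun k => trigpoly (coef k) (d k) in
    torus_E (fun t => l2 K (fun k => f (S k) t)) = sqrt (INR n) /\
    INR n / 2 <= torus_E (fun t => l2 K (fun k => condexpN (N (S k)) (f (S k)) t)) /\
    INR n - 1 / 4 <= ind_norm (fun k => condexpN (N k) (f k)) K.
Proof.
  intros HNpos HS Hd HL HL4 Hbig.
  set (M := fun l => N (S k0 + 2 * l)%nat) in *.
  (* There are [n] blocks of [L] factors; one block corresponds to [2 * L] indices of [N]. *)
  set (T := (n * L)%nat) in *. set (s := (2 * L)%nat).
  destruct (riesz_cospoly M 0 T HS) as (m & Hm & Hcos).
  destruct (cospoly_trigpoly m 1 (riesz M 0 T) (M T) ltac:(simpl in Hm; lia) Hcos) as [A HA].
  set (coef := fun k => if (Nat.leb (S k0) k && Nat.eqb ((k - S k0) mod s) 0)%bool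
                        then A else fun _ => RtoC 0).
  exists (k0 + n * s)%nat, coef. intros f.
  (* The tail from block [b] on, which is the modulus of the conditional expectation at the [b]-th
     active index. *)
  set (G := fun b => riesz M (b * L) (T - b * L)).
  assert (HG0 : forall b t, 0 <= G b t) by (intros; apply riesz_nonneg).
  assert (HGc : forall b, cper (G b)) by (intros; now apply cper_riesz).
  assert (HG1 : forall b, torus_E (G b) = 1) by (intros; now apply torus_E_riesz).
  assert (Hon : forall i, coef (S (k0 + i * s)) = A).
  { intros i. unfold coef. replace (S (k0 + i * s) - S k0)%nat with (0 + i * s)%nat by lia.
    rewrite Nat.Div0.mod_add, Nat.Div0.mod_0_l.
    rewrite (proj2 (Nat.leb_le (S k0) (S (k0 + i * s)))) by lia. reflexivity. }
  assert (Hlow : forall j, (j < k0)%nat -> coef (S j) = fun _ => RtoC 0).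
  { intros j Hj. unfold coef. now rewrite (proj2 (Nat.leb_gt (S k0) (S j))) by lia. }
  assert (Hoff : forall i r, (0 < r < s)%nat ->
            coef (S (k0 + (i * s + r))) = fun _ => RtoC 0).
  { intros i r Hr. unfold coef.
    replace (S (k0 + (i * s + r)) - S k0)%nat with (r + i * s)%nat by lia.
    rewrite Nat.Div0.mod_add, Nat.mod_small by lia.
    rewrite (proj2 (Nat.eqb_neq r 0)) by lia. now rewrite Bool.andb_false_r. }
  assert (Hfon : forall i t, f (S (k0 + i * s)) t
            = Cmult (cexpi (INR (M T) * t)) (RtoC (riesz M 0 T t))).
  { intros i t. unfold f. rewrite Hon. apply HA.
    eapply Nat.le_trans; [exact Hbig|].
    replace (S (k0 + i * s)) with (S k0 + i * s)%nat by lia. apply Hd. }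
  assert (Hcon : forall i t, (i < n)%nat ->
            Cmod (condexpN (N (S (k0 + i * s))) (f (S (k0 + i * s))) t) = G i t).
  { intros i t Hi. rewrite (condexpN_ext _ _ _ _ (Hfon i)).
    replace (N (S (k0 + i * s))) with (M (i * L)%nat)
      by (unfold M, s; f_equal; lia).
    pose proof (condexpN_riesz M (i * L) (T - i * L) t HS) as H.
    replace (i * L + (T - i * L))%nat with T in H by (unfold T; nia).
    rewrite H, Cmod_mult, Cmod_cexpi, Cmod_R, Rabs_pos_eq by apply HG0.
    unfold G. ring. }
  assert (Hzero : forall j t, coef (S j) = (fun _ => RtoC 0) ->
            Cmod (f (S j) t) = 0 /\ Cmod (condexpN (N (S j)) (f (S j)) t) = 0).
  { intros j t Hj.
    assert (Hfj : forall t, f (S j) t = RtoC 0)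
      by (intros; unfold f; rewrite Hj; apply trigpoly_zero).
    split; [rewrite Hfj; apply Cmod_0|].
    rewrite (condexpN_ext _ _ _ _ Hfj), condexpN_zero by auto. apply Cmod_0. }
  assert (Hs : (1 <= s)%nat) by (unfold s; lia).
  assert (Hcross : forall b b', (b <= b' <= n)%nat ->
            torus_E (fun t => sqrt (G b t * G b' t)) <= (1 / 4) ^ (b' - b)).
  { intros b b' Hb.
    pose proof (torus_E_sqrt_riesz M (b * L) ((b' - b) * L) (T - b' * L) HS) as H.
    replace ((b' - b) * L + (T - b' * L))%nat with (T - b * L)%nat in H by (unfold T; nia).
    replace (b * L + (b' - b) * L)%nat with (b' * L)%nat in H by nia.
    eapply Rle_trans; [exact H|].
    rewrite Nat.mul_comm, pow_mult. apply pow_incr. split; auto.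
    apply pow_le; lra. }
  (* The empty tail; with it, the bound on the means of [sqrt (G i)] becomes a case of [Hcross]. *)
  assert (HGn : forall t, G n t = 1).
  { intros t. unfold G, T. rewrite Nat.sub_diag. reflexivity. }
  split; [|split].
  - rewrite (torus_E_ext _ (fun t => sqrt (INR n) * riesz M 0 T t)).
    + rewrite torus_E_scal by now apply cper_riesz.
      rewrite torus_E_riesz by auto. ring.
    + intros t. unfold l2.
      rewrite (Rsum_sparse k0 s n (fun k => Cmod (f (S k) t) ^ 2)); auto.
      * rewrite (Rsum_ext _ _ (fun _ => riesz M 0 T t ^ 2)).
        -- rewrite Rsum_const, sqrt_mult, sqrt_pow2; auto.
           ++ apply riesz_nonneg.
           ++ apply pos_INR.
           ++ apply pow2_ge_0.
        -- intros i _. rewrite Hfon, Cmod_mult, Cmod_cexpi, Cmod_R.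
           rewrite Rabs_pos_eq by apply riesz_nonneg. ring.
      * intros j Hj. rewrite (proj1 (Hzero j t (Hlow j Hj))). ring.
      * intros i r Hr. rewrite (proj1 (Hzero _ t (Hoff i r Hr))). ring.
  - set (X := fun t => Rsum n (fun b => G b t)).
    set (Y := fun t => Rsum n (fun b' => Rsum b' (fun b => sqrt (G b t * G b' t)))).
    assert (Hcs : forall b b', cper (fun t => sqrt (G b t * G b' t)))
      by (intros; apply cper_sqrt, cper_mult; auto).
    assert (HcY : forall b', cper (fun t => Rsum b' (fun b => sqrt (G b t * G b' t))))
      by (intros b'; apply (cper_sum b' (fun b t => sqrt (G b t * G b' t))); auto).
    assert (HX : cper X) by (apply (cper_sum n G); auto).
    assert (HY : cper Y)
      by (apply (cper_sum n (fun b' t => Rsum b' (fun b => sqrt (G b t * G b' t)))); auto).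
    assert (HEX : torus_E X = INR n).
    { unfold X. rewrite (torus_E_sum n G) by auto.
      rewrite (Rsum_ext _ _ (fun _ => 1)) by auto. rewrite Rsum_const. ring. }
    assert (HEY : torus_E Y <= INR n / 2).
    { unfold Y.
      rewrite (torus_E_sum n (fun b' t => Rsum b' (fun b => sqrt (G b t * G b' t)))) by auto.
      replace (INR n / 2) with (INR n * (1 / 2)) by field. rewrite <- Rsum_const.
      apply Rsum_le; intros b' Hb'.
      rewrite (torus_E_sum b' (fun b t => sqrt (G b t * G b' t))) by auto.
      eapply Rle_trans; [|apply (quarter_sum_le b')].
      apply Rsum_le; intros b Hb. apply Hcross; lia. }
    apply Rle_trans with (torus_E (fun t => X t - Y t)).
    + rewrite torus_E_minus by auto. lra.
    + apply torus_E_le.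
      * now apply cper_minus.
      * apply (cper_l2 (k0 + n * s) (fun k => condexpN (N (S k)) (f (S k)))).
        intros k. apply ccper_condexpN; auto. apply ccper_trigpoly.
      * intros t. unfold l2.
        rewrite (Rsum_sparse k0 s n (fun k => Cmod (condexpN (N (S k)) (f (S k)) t) ^ 2));
          auto.
        -- pose proof (l2_ge n (fun b => RtoC (G b t))) as H. unfold l2 in H.
           assert (Habs : forall b, Cmod (RtoC (G b t)) = G b t)
             by (intros; rewrite Cmod_R; now apply Rabs_pos_eq).
           rewrite (Rsum_ext n _ (fun b => Cmod (RtoC (G b t)) ^ 2))
             by (intros; rewrite Habs, Hcon; auto).
           eapply Rle_trans; [|exact H]. right. unfold X, Y. f_equal.
           ++ apply Rsum_ext; auto.
           ++ apply Rsum_ext; intros. apply Rsum_ext; intros.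
              now rewrite !Habs.
        -- intros j Hj. rewrite (proj2 (Hzero j t (Hlow j Hj))). ring.
        -- intros i r Hr. rewrite (proj2 (Hzero _ t (Hoff i r Hr))). ring.
  - assert (Hg : forall j, (1 <= j)%nat -> ccper (condexpN (N j) (f j))).
    { intros [|j] Hj; [lia|]. apply ccper_condexpN; auto. apply ccper_trigpoly. }
    pose proof (ind_aux_ge (fun k => condexpN (N k) (f k)) (k0 + n * s) 1 0
      ltac:(lra) Hg) as H.
    cbv zeta in H. unfold ind_norm. eapply Rle_trans; [|exact H]. clear H.
    cbn [Nat.add]. rewrite !sqrt_0, !Rplus_0_l.
    rewrite (Rsum_sparse k0 s n
      (fun j => torus_E (fun t => Cmod (condexpN (N (S j)) (f (S j)) t)))); auto.
    2: { intros j Hj. rewrite (torus_E_ext _ (fun _ => 0)); [apply torus_E_const|].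
         intros t. apply (Hzero j t (Hlow j Hj)). }
    2: { intros i r Hr. rewrite (torus_E_ext _ (fun _ => 0)); [apply torus_E_const|].
         intros t. apply (Hzero _ t (Hoff i r Hr)). }
    rewrite (Rsum_sparse k0 s n
      (fun j => torus_E (fun t => sqrt (Cmod (condexpN (N (S j)) (f (S j)) t))))); auto.
    2: { intros j Hj. rewrite (torus_E_ext _ (fun _ => 0)); [apply torus_E_const|].
         intros t. rewrite (proj2 (Hzero j t (Hlow j Hj))). apply sqrt_0. }
    2: { intros i r Hr. rewrite (torus_E_ext _ (fun _ => 0)); [apply torus_E_const|].
         intros t. rewrite (proj2 (Hzero _ t (Hoff i r Hr))). apply sqrt_0. }
    rewrite (Rsum_ext n (fun i => torus_E (fun t =>
        Cmod (condexpN (N (S (k0 + i * s))) (f (S (k0 + i * s))) t))) (fun _ => 1)).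
    2: { intros i Hi. rewrite <- (HG1 i). apply torus_E_ext; auto. }
    set (e := Rsum n (fun i => torus_E (fun t =>
        sqrt (Cmod (condexpN (N (S (k0 + i * s))) (f (S (k0 + i * s))) t))))).
    assert (He : e = Rsum n (fun i => torus_E (fun t => sqrt (G i t * G n t)))).
    { apply Rsum_ext; intros i Hi. apply torus_E_ext; intros t.
      now rewrite Hcon, HGn, Rmult_1_r by auto. }
    assert (He0 : 0 <= e).
    { rewrite He. apply Rsum_nonneg; intros i _. apply torus_E_ge_const.
      - apply cper_sqrt, cper_mult; auto.
      - intros; apply sqrt_pos. }
    assert (He1 : e <= 1 / 2).
    { rewrite He. eapply Rle_trans; [|apply (quarter_sum_le n)].
      apply Rsum_le; intros i Hi. apply Hcross; lia. }
    rewrite Rsum_const. nra.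
Qed.

Lemma lacunary_mono d : lacunary d -> forall k l, (1 <= k)%nat -> (d k <= d (k + l))%nat.
Proof.
  intros [_ (q & Hq & H)] k l Hk. induction l as [|l IH].
  - rewrite Nat.add_0_r; lia.
  - rewrite Nat.add_succ_r. eapply Nat.le_trans; [exact IH|].
    apply INR_le. specialize (H (k + l)%nat ltac:(lia)).
    pose proof (pos_INR (d (k + l)%nat)). nra.
Qed.

(** Allowing either inequality for each family treats (ii) and (iii) together, as the test family
    violates both. *)
Lemma cond_i_of_test (d N : nat -> nat) (c : R) :
  lacunary d ->
  (forall k, (1 <= k)%nat -> Nat.divide (N k) (N (S k))) ->
  (forall k, (1 <= k)%nat -> (N k < N (S k))%nat) ->
  0 < c ->
  (forall K (coef : nat -> nat -> C),
    let f := fun k => trigpoly (coef k) (d k) in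
    c * torus_E (fun t => l2 K (fun k => condexpN (N (S k)) (f (S k)) t))
      <= torus_E (fun t => l2 K (fun k => f (S k) t)) \/
    c * ind_norm (fun k => condexpN (N k) (f k)) K
      <= torus_E (fun t => l2 K (fun k => f (S k) t))) ->
  exists (a : nat) (C0 : R),
    forall k, (1 <= k)%nat -> INR (d k) <= C0 * INR (N (k + a)%nat).
Proof.
  intros Hlac Hdiv Hlt Hc Hineq. apply NNPP; intros Hnot.
  pose proof (growth_pow2 N Hdiv Hlt) as HN.
  destruct (pow_lt_1_zero (31 / 32)) with (y := 1 / 4) as [L HL]; try lra.
  { rewrite Rabs_pos_eq; lra. }
  assert (HL4 : (31 / 32) ^ S L <= 1 / 4).
  { specialize (HL (S L) ltac:(lia)).
    rewrite Rabs_pos_eq in HL by (apply pow_le; lra). lra. }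
  (* With [n = n0^2] test functions the left-hand side is [n0], while the right-hand sides are at
     least [c * n0^2 / 2 > n0]. *)
  destruct (INR_unbounded (2 / c)) as [n0 Hn0].
  assert (Hcn : 2 < c * INR n0).
  { replace 2 with (c * (2 / c)) by (field; lra). apply Rmult_lt_compat_l; lra. }
  assert (Hn1 : (1 <= n0)%nat).
  { destruct n0; [simpl in Hcn; lra | lia]. }
  set (n := (n0 * n0)%nat).
  (* Failure of (i) for the shift [2 * (n * S L)] and the constant 2 gives an index whose degree
     bound accommodates the whole Riesz product. *)
  assert (Hk : exists k0, (2 * N (S k0 + 2 * (n * S L)) <= d (S k0))%nat).
  { apply NNPP; intros Hk. apply Hnot. exists (2 * (n * S L))%nat, 2.
    intros [|k0] Hk1; [lia|].
    destruct (Nat.le_gt_cases (2 * N (S k0 + 2 * (n * S L))%nat) (d (S k0))) as [H|H].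
    - exfalso. apply Hk. now exists k0.
    - apply Nat.lt_le_incl, le_INR in H. rewrite mult_INR in H. simpl (INR 2) in H. lra. }
  destruct Hk as [k0 Hk0].
  destruct (riesz_test d N k0 (S L) n) as (K & coef & H1 & H2 & H3); auto; try lia.
  - intros l. apply HN; lia.
  - repeat split.
    + apply HN; lia.
    + intros l. destruct (HN (S k0 + 2 * l)%nat ltac:(lia)) as [_ H].
      specialize (H 2%nat). replace (S k0 + 2 * S l)%nat with (S k0 + 2 * l + 2)%nat by lia.
      simpl (2 ^ 2)%nat in H. lia.
    + intros l. replace (S k0 + 2 * S l)%nat with (S (S (S k0 + 2 * l))) by lia.
      eapply Nat.divide_trans; apply Hdiv; lia.
  - intros l. apply lacunary_mono; auto; lia.
  - specialize (Hineq K coef). cbv beta zeta in Hineq. rewrite H1 in Hineq.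
    unfold n in *. rewrite mult_INR in *. rewrite sqrt_square in Hineq by apply pos_INR.
    assert (Hn : 1 <= INR n0) by (apply (le_INR 1); auto).
    destruct Hineq as [H|H]; nra.
Qed.

Theorem theorem2p3 (d N : nat -> nat)
  (hd : lacunary d)
  (hdiv : forall k, (1 <= k)%nat -> Nat.divide (N k) (N (S k)))
  (hlt : forall k, (1 <= k)%nat -> (N k < N (S k))%nat) :
  let cond_i := exists (a : nat) (C0 : R),
      forall k, (1 <= k)%nat -> INR (d k) <= C0 * INR (N (k + a)%nat) in
  let cond_ii := exists c : R, 0 < c /\
      forall (n : nat) (coef : nat -> nat -> C),
        let f := fun k => trigpoly (coef k) (d k) in
        torus_E (fun t => sqrt (sum_n_m (fun k => (Cmod (f k t)) ^ 2) 1 n))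
        >= c * torus_E (fun t =>
             sqrt (sum_n_m (fun k => (Cmod (condexpN (N k) (f k) t)) ^ 2) 1 n)) in
  let cond_iii := exists c : R, 0 < c /\
      forall (n : nat) (coef : nat -> nat -> C),
        let f := fun k => trigpoly (coef k) (d k) in
        L1l2_norm f n >= c * ind_norm (fun k => condexpN (N k) (f k)) n in
  (cond_i <-> cond_ii) /\ (cond_i <-> cond_iii).
Proof.
  intros cond_i cond_ii cond_iii.
  assert (El2 : forall n (g : nat -> R -> C),
    torus_E (fun t => sqrt (sum_n_m (fun k => (Cmod (g k t)) ^ 2) 1 n))
    = torus_E (fun t => l2 n (fun k => g (S k) t))).
  { intros n g. apply torus_E_ext; intros t. apply (sqrt_sum_n_m_l2 n (fun k => g k t)). }
  assert (Hfwd : cond_i -> cond_ii /\ cond_iii).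
  { intros (a & C0 & H).
    destruct (cond_i_bounds d N a C0 (proj1 hd) (growth_pow2 N hdiv hlt) H)
      as (c & Hc & Hb).
    split; exists c; (split; [exact Hc|]); intros n coef f;
      destruct (Hb n coef) as [H2 H3]; apply Rle_ge.
    - rewrite (El2 n f), (El2 n (fun k => condexpN (N k) (f k))). exact H2.
    - unfold L1l2_norm. rewrite (El2 n f). exact H3. }
  split; (split; [apply Hfwd|]); intros (c & Hc & H);
    apply (cond_i_of_test d N c hd hdiv hlt Hc); intros K coef f;
    specialize (H K coef); cbv zeta in H; apply Rge_le in H.
  - left. rewrite <- (El2 K f), <- (El2 K (fun k => condexpN (N k) (f k))). exact H.
  - right. rewrite <- (El2 K f). exact H.
Qed.
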